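(* The precise value of the convex Fujita number $\mathrm{Fu}(X)$ of a smooth connected projective variety $X$ over $\mathbb{C}$ is not determined by the fundamental group $\pi_1(X)$ alone; that is, there exist smooth connected projective varieties $X$ and $X'$ over $\mathbb{C}$ with $\pi_1(X) \cong \pi_1(X')$ and $\mathrm{Fu}(X) \neq \mathrm{Fu}(X')$.
   Context: All varieties are over $\mathbb{C}$, and $\pi_1(X)$ denotes the topological fundamental group. The convex Fujita number $\mathrm{Fu}(X)$ of a smooth projective variety $X$ is the minimal integer $m \geq 0$ such that for all integers $s \geq m$ and any ample divisors $L_1, \ldots, L_s$ on $X$ the adjoint divisor $K_X + L_1 + \cdots + L_s$ is globally generated (for $s=0$ this is $K_X$ itself); if no such $m$ exists, $\mathrm{Fu}(X)=\infty$. *)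

(* Defs.v *)
From HB Require Import structures.
From mathcomp Require Import all_boot all_order all_algebra.
From mathcomp Require Import -(notations) mpoly.
From mathcomp Require Import ring lra complex.
From mathcomp Require Import all_classical all_reals all_analysis.

Set Implicit Arguments.
Unset Strict Implicit.
Unset Printing Implicit Defensive.

Import Order.TTheory GRing.Theory Num.Theory.
Import numFieldNormedType.Exports.

Local Open Scope ring_scope.
Local Open Scope classical_set_scope.
Local Open Scope quotient_scope.

(** * The fundamental group *)

Section FundamentalGroup.
Variables (R : realType) (T : topologicalType).

Local Notation I01 := (`[0, 1] : set R).

(* Loops are total functions on R of which only the restriction to [0, 1]
   matters: any two extensions of the same map are homotopic below. *)
Record is_loop (A : set T) (x : T) (g : R -> T) : Prop := IsLoop {
  loop_cts : {within I01, continuous g};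
  loop_in : forall s, I01 s -> A (g s);
  loop0 : g 0 = x;
  loop1 : g 1 = x
}.

Definition loop (A : set T) (x : T) : Type := {g : R -> T | is_loop A x g}.

HB.instance Definition _ A x := gen_eqMixin (loop A x).
HB.instance Definition _ A x := gen_choiceMixin (loop A x).

Record is_homotopy (A : set T) (x : T) (g h : R -> T) (H : R * R -> T) : Prop :=
  IsHomotopy {
  homotopy_cts : {within I01 `*` I01, continuous H};
  homotopy_in : forall s t, I01 s -> I01 t -> A (H (s, t));
  homotopy_start : forall s, I01 s -> H (s, 0) = g s;
  homotopy_end : forall s, I01 s -> H (s, 1) = h s;
  homotopy_left : forall t, I01 t -> H (0, t) = x;
  homotopy_right : forall t, I01 t -> H (1, t) = x
}.

Definition homotopic (A : set T) (x : T) (g h : loop A x) : bool :=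
  `[< exists H, is_homotopy A x (sval g) (sval h) H >].

Definition concat (g h : R -> T) : R -> T :=
  fun s => if s <= 2^-1 then g (2 * s) else h (2 * s - 1).

Lemma within_comp (U V W : topologicalType) (D : set U) (E : set V)
    (f : U -> V) (k : V -> W) :
  continuous f -> (forall u, D u -> E (f u)) ->
  {within E, continuous k} -> {within D, continuous (k \o f)}.
Proof.
move=> cf DE ck; apply/continuousP => O oO.
move/continuousP: ck => /(_ O oO) /open_subspaceP [V2 oV2 VE].
apply/open_subspaceP; exists (f @^-1` V2); first exact: open_comp.
apply/seteqP; split => u [] /= h Du; split => //.
- by have [] : ((k @^-1` O) `&` E) (f u) by rewrite -VE; split => //; exact: DE.
- by have [] : (V2 `&` E) (f u) by rewrite VE; split => //; exact: DE.
Qed.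

Lemma within_congr (U W : topologicalType) (D : set U) (f k : U -> W) :
  (forall u, D u -> f u = k u) ->
  {within D, continuous f} -> {within D, continuous k}.
Proof.
move=> fk /continuousP cf; apply/continuousP => O /cf /open_subspaceP [V oV VD].
apply/open_subspaceP; exists V => //; rewrite VD.
by apply/seteqP; split => u [] /= h Du; split => //=; move: h;
  rewrite /from_subspace /= ?(fk _ Du).
Qed.

Lemma closed_setX (U V : topologicalType) (D : set U) (E : set V) :
  closed D -> closed E -> closed (D `*` E).
Proof.
move=> cD cE.
have -> : D `*` E = (fst @^-1` D) `&` (snd @^-1` E) by [].
by apply: closedI; apply: preimage_closed => // u _;
  [exact: cvg_fst | exact: cvg_snd].
Qed.

Lemma continuous_pair (U V W : topologicalType) (f : U -> V) (k : U -> W) :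
  continuous f -> continuous k -> continuous (fun u => (f u, k u)).
Proof. by move=> cf ck u; exact: (cvg_pair (cf u) (ck u)). Qed.

Lemma within_paste (U W : topologicalType) (D D1 D2 : set U) (f f1 f2 : U -> W) :
  D `<=` D1 `|` D2 -> closed D1 -> closed D2 ->
  (forall u, D1 u -> f1 u = f u) -> (forall u, D2 u -> f2 u = f u) ->
  {within D1, continuous f1} -> {within D2, continuous f2} ->
  {within D, continuous f}.
Proof.
move=> sD cD1 cD2 f1E f2E c1 c2.
apply: (@continuous_subspaceW _ _ _ (D1 `|` D2)) => //.
by apply: withinU_continuous => //; [apply: within_congr c1|apply: within_congr c2].
Qed.

Let half : R := 2^-1.

Lemma concat_loop A x g h :
  is_loop A x g -> is_loop A x h -> is_loop A x (concat g h).
Proof.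
move=> [cg gA g0 g1] [ch hA h0 h1]; split.
- apply: (@within_paste R T _ `[0, half] `[half, 1] _
            (g \o ( *%R 2)) (h \o (fun s => 2 * s - 1))).
  + move=> s /=; rewrite !in_itv /= => /andP[s0 s1].
    by case: (leP s half) => hs; [left|right]; lra.
  + exact: interval_closed.
  + exact: interval_closed.
  + by move=> s /=; rewrite in_itv /= /concat => /andP[_ ->].
  + move=> s /=; rewrite in_itv /= /concat /half => /andP[s0 s1].
    case: ifP => // s2; have -> : s = 2^-1 by lra.
    by rewrite divff ?subrr ?h0 ?g1 // pnatr_eq0.
  + apply: within_comp cg; first exact: mulrl_continuous.
    by move=> s /=; rewrite !in_itv /= /half; lra.
  + apply: within_comp ch.
      move=> s; apply: cvgB; last exact: cvg_cst.
      exact: mulrl_continuous.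
    by move=> s /=; rewrite !in_itv /= /half; lra.
- move=> s /=; rewrite in_itv /= /concat => /andP[s0 s1].
  by case: leP => hs; [apply: gA|apply: hA]; rewrite /= in_itv /=; lra.
- by rewrite /concat mulr0 invr_ge0 ler0n.
- rewrite /concat mulr1 ifF; last by apply/negbTE; rewrite -ltNge; lra.
  by rewrite (_ : 2 - 1 = 1 :> R) //; lra.
Qed.

Definition loop_mul A x (g h : loop A x) : loop A x :=
  exist _ (concat (sval g) (sval h)) (concat_loop (svalP g) (svalP h)).

Lemma homotopic_refl A x : reflexive (@homotopic A x).
Proof.
move=> [g [cg gA g0 g1]]; apply/asboolP; exists (g \o fst); split => //=.
- apply: within_comp cg; last by move=> u [].
  by move=> u; exact: cvg_fst.
- by move=> s t s01 _; exact: gA.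
Qed.

Lemma homotopic_sym A x : ssrbool.symmetric (@homotopic A x).
Proof.
suff sub g h : @homotopic A x g h -> homotopic h g.
  by move=> g h; apply/idP/idP; exact: sub.
move=> /asboolP [H [cH HA H0 H1 Hl Hr]]; apply/asboolP.
have flip (t : R) : I01 t -> I01 (1 - t) by rewrite /= !in_itv /=; lra.
exists (H \o (fun u => (u.1, 1 - u.2))); split => /=.
- apply: within_comp cH; last by move=> u [/= ? ?]; split => //; exact: flip.
  apply: continuous_pair => u; first exact: cvg_fst.
  by apply: cvgB; [exact: cvg_cst | exact: cvg_snd].
- by move=> s t s01 t01; apply: HA => //; exact: flip.
- by move=> s s01; rewrite subr0 H1.
- by move=> s s01; rewrite subrr H0.
- by move=> t t01; rewrite Hl //; exact: flip.
- by move=> t t01; rewrite Hr //; exact: flip.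
Qed.

Lemma homotopic_trans A x : transitive (@homotopic A x).
Proof.
move=> h g k /asboolP [H [cH HA H0 H1 Hl Hr]] /asboolP [K [cK KA K0 K1 Kl Kr]].
apply/asboolP.
exists (fun u => concat (fun t => H (u.1, t)) (fun t => K (u.1, t)) u.2).
have low (t : R) : 0 <= t <= half -> I01 (2 * t).
  by rewrite /= in_itv /= /half; lra.
have high (t : R) : half <= t <= 1 -> I01 (2 * t - 1).
  by rewrite /= in_itv /= /half; lra.
split => /=.
- apply: (@within_paste (R * R)%type T _ (I01 `*` `[0, half]) (I01 `*` `[half, 1]) _
            (H \o (fun u => (u.1, 2 * u.2))) (K \o (fun u => (u.1, 2 * u.2 - 1)))).
  + move=> u [/= u1]; rewrite !in_itv /= => u2.
    by case: (leP u.2 half) => hs; [left|right]; split => //=; rewrite ?in_itv /=; lra.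
  + by apply: closed_setX; exact: interval_closed.
  + by apply: closed_setX; exact: interval_closed.
  + by move=> u [/= _]; rewrite in_itv /= /concat => /andP[_ ->].
  + move=> u [/= u1]; rewrite in_itv /= /concat /half => u2.
    case: ifP => // s2; have -> : u.2 = 2^-1 by lra.
    by rewrite divff ?subrr ?K0 ?H1 // pnatr_eq0.
  + apply: within_comp cH.
      apply: continuous_pair => u; first exact: cvg_fst.
      by apply: cvgM; [exact: cvg_cst | exact: cvg_snd].
    by move=> u [/= ? +]; rewrite in_itv /= => /low.
  + apply: within_comp cK.
      apply: continuous_pair => u; first exact: cvg_fst.
      apply: cvgB; last exact: cvg_cst.
      by apply: cvgM; [exact: cvg_cst | exact: cvg_snd].
    by move=> u [/= ? +]; rewrite in_itv /= => /high.
- move=> s t s01; rewrite /= in_itv /= /concat /half => t01.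
  by case: leP => ht; [apply: HA => //; apply: low | apply: KA => //; apply: high];
    rewrite /half; lra.
- by move=> s s01; rewrite /concat mulr0 invr_ge0 ler0n H0.
- move=> s s01; rewrite /concat mulr1 ifF; last by apply/negbTE; rewrite -ltNge; lra.
  by rewrite (_ : 2 - 1 = 1 :> R) ?K1 //; lra.
- move=> t; rewrite /= in_itv /= /concat /half => t01.
  by case: leP => ht; [apply: Hl; apply: low | apply: Kl; apply: high];
    rewrite /half; lra.
- move=> t; rewrite /= in_itv /= /concat /half => t01.
  by case: leP => ht; [apply: Hr; apply: low | apply: Kr; apply: high];
    rewrite /half; lra.
Qed.

Canonical homotopic_equiv A x := EquivRel (@homotopic A x)
  (@homotopic_refl A x) (@homotopic_sym A x) (@homotopic_trans A x).

Definition pi1 (A : set T) (x : T) : Type := {eq_quot (@homotopic A x)}.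

HB.instance Definition _ A x := Quotient.on (pi1 A x).

Definition pi1_mul A x (a b : pi1 A x) : pi1 A x :=
  \pi_(pi1 A x) (loop_mul (repr a) (repr b)).

(* pi1_mul does not depend on the chosen representatives *)
Lemma pi1_mulE A x (g h : loop A x) :
  pi1_mul (\pi_(pi1 A x) g) (\pi_(pi1 A x) h) = \pi_(pi1 A x) (loop_mul g h).
Proof.
have /eqmodP := reprK (\pi_(pi1 A x) g); have /eqmodP := reprK (\pi_(pi1 A x) h).
rewrite /pi1_mul; set g' := repr (\pi g); set h' := repr (\pi h).
move=> /asboolP [K [cK KA K0 K1 Kl Kr]] /asboolP [H [cH HA H0 H1 Hl Hr]].
apply/eqmodP/asboolP.
exists (fun u => concat (fun s => H (s, u.2)) (fun s => K (s, u.2)) u.1).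
have low (s : R) : 0 <= s <= half -> I01 (2 * s).
  by rewrite /= in_itv /= /half; lra.
have high (s : R) : half <= s <= 1 -> I01 (2 * s - 1).
  by rewrite /= in_itv /= /half; lra.
split => /=.
- apply: (@within_paste (R * R)%type T _ (`[0, half] `*` I01) (`[half, 1] `*` I01) _
            (H \o (fun u => (2 * u.1, u.2))) (K \o (fun u => (2 * u.1 - 1, u.2)))).
  + move=> u [/= + u2]; rewrite !in_itv /= => u1.
    by case: (leP u.1 half) => hs; [left|right]; split => //=; rewrite ?in_itv /=; lra.
  + by apply: closed_setX; exact: interval_closed.
  + by apply: closed_setX; exact: interval_closed.
  + by move=> u [/= + _]; rewrite in_itv /= /concat => /andP[_ ->].
  + move=> u [/= + u2]; rewrite in_itv /= /concat /half => u1.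
    case: ifP => // s2; have -> : u.1 = 2^-1 by lra.
    by rewrite divff ?subrr ?Kl ?Hr // pnatr_eq0.
  + apply: within_comp cH.
      apply: continuous_pair => u; last exact: cvg_snd.
      by apply: cvgM; [exact: cvg_cst | exact: cvg_fst].
    by move=> u [/= +]; rewrite in_itv /= => /low.
  + apply: within_comp cK.
      apply: continuous_pair => u; last exact: cvg_snd.
      apply: cvgB; last exact: cvg_cst.
      by apply: cvgM; [exact: cvg_cst | exact: cvg_fst].
    by move=> u [/= +]; rewrite in_itv /= => /high.
- move=> s t; rewrite /= in_itv /= /concat /half => s01 t01.
  by case: leP => hs; [apply: HA => //; apply: low | apply: KA => //; apply: high];
    rewrite /half; lra.
- move=> s; rewrite /= in_itv /= /concat /half => s01.
  by case: leP => hs; [apply: H0; apply: low | apply: K0; apply: high];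
    rewrite /half; lra.
- move=> s; rewrite /= in_itv /= /concat /half => s01.
  by case: leP => hs; [apply: H1; apply: low | apply: K1; apply: high];
    rewrite /half; lra.
- by move=> t t01; rewrite /concat mulr0 invr_ge0 ler0n Hl.
- move=> t t01; rewrite /concat mulr1 ifF; last by apply/negbTE; rewrite -ltNge; lra.
  by rewrite (_ : 2 - 1 = 1 :> R) ?Kr //; lra.
Qed.

End FundamentalGroup.

(* Isomorphism of fundamental groups, for nonempty path-connected A and B: the
   base points are then immaterial. *)
Definition pi1_isomorphic (R : realType) (T U : topologicalType)
    (A : set T) (B : set U) : Prop :=
  forall x y, A x -> B y -> exists phi : pi1 R A x -> pi1 R B y,
    bijective phi /\ {morph phi : a b / pi1_mul a b}.

(** * Projective space *)

Lemma frac_sub (F : fieldType) (a b c d : F) : b != 0 -> d != 0 ->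
  a / b - c / d = (a * d - c * b) / (b * d).
Proof. by move=> b0 d0; field; rewrite b0 d0. Qed.

Lemma frac_div (F : fieldType) (a b c d : F) :
  (a / b) / (c / d) = (a * d) / (b * c).
Proof. by rewrite invf_div mulf_div. Qed.

Lemma fraction_surj (D : idomainType) (h : {fraction D}) :
  exists a b : D, b != 0 /\ h = FracField.tofrac a / FracField.tofrac b.
Proof.
elim/quotW: h => x; exists (frac x).1, (frac x).2; have dx := denom_ratioP x; split => //.
have dx0 : FracField.tofrac (frac x).2 != 0 by rewrite tofrac_eq0.
apply: (canRL (mulfK dx0)); unlock FracField.tofrac.
rewrite -[LHS]FracField.pi_mul; apply/eqmodP.
rewrite /= FracField.equivfE /FracField.mulf.
by rewrite !numden_Ratio ?oner_eq0 ?mulf_neq0 ?dx ?oner_neq0 // !mulr1 mulrC.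
Qed.

Section ProjectiveSpace.
Variables (C : numClosedFieldType) (n : nat).

Definition nonzero_vec : set 'rV[C]_n.+1 := [set v | v != 0].

(* The scalar c is automatically nonzero *)
Definition collinear (v w : nonzero_vec) : bool :=
  `[< exists c : C, \val v = c *: \val w >].

Lemma collinear_refl : reflexive collinear.
Proof. by move=> v; apply/asboolP; exists 1; rewrite scale1r. Qed.

Lemma collinear_sym : ssrbool.symmetric collinear.
Proof.
suff sub v w : collinear v w -> collinear w v.
  by move=> v w; apply/idP/idP; exact: sub.
move=> /asboolP [c vw]; apply/asboolP; exists c^-1.
rewrite vw scalerA mulVf ?scale1r //.
apply/eqP => c0; have : \val v != 0 by exact: (set_mem (valP v)).
by rewrite vw c0 scale0r eqxx.
Qed.

Lemma collinear_trans : transitive collinear.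
Proof.
move=> v u w /asboolP [c uv] /asboolP [d vw].
by apply/asboolP; exists (c * d); rewrite uv vw scalerA.
Qed.

Canonical collinear_equiv :=
  EquivRel collinear collinear_refl collinear_sym collinear_trans.

(* P^n(C) with its classical topology *)
Definition proj : Type := quotient_topology {eq_quot collinear}.

HB.instance Definition _ := Quotient.on proj.
HB.instance Definition _ := Topological.on proj.

Definition hcoord (p : proj) : 'I_n.+1 -> C := fun i => (\val (repr p)) ord0 i.

Definition is_homog (d : nat) (f : mpoly n.+1 C) : bool := f \is ishomog1 d mdeg.

(* Only used for f homogeneous, so that the choice of representative made by
   hcoord is immaterial. *)
Definition vanishes_at (f : mpoly n.+1 C) (p : proj) : Prop :=
  meval (hcoord p) f = 0.

(** ** The Zariski topology *)

Definition zclosed (A : set proj) : Prop :=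
  exists F : set (mpoly n.+1 C), (forall f, F f -> exists d, is_homog d f) /\
    A = [set p | forall f, F f -> vanishes_at f p].

Definition zirreducible (A : set proj) : Prop :=
  A !=set0 /\ forall B1 B2, zclosed B1 -> zclosed B2 -> A `<=` B1 `|` B2 ->
    A `<=` B1 \/ A `<=` B2.

Definition zconnected (A : set proj) : Prop :=
  A !=set0 /\ forall B1 B2, zclosed B1 -> zclosed B2 -> A `<=` B1 `|` B2 ->
    A `&` B1 `&` B2 = set0 -> A `<=` B1 \/ A `<=` B2.

(* Irreducibility is no restriction for smooth varieties: a smooth connected
   variety is irreducible. *)
Record pvariety := PVariety {
  pv_set :> set proj;
  pv_closed : zclosed pv_set;
  pv_irreducible : zirreducible pv_set
}.

Definition closed_chain (X : set proj) (d : nat) : Prop :=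
  exists Z : nat -> set proj,
    (forall i, (i <= d)%N -> zclosed (Z i) /\ zirreducible (Z i) /\ Z i `<=` X) /\
    (forall i, (i < d)%N -> Z i `<` Z i.+1).

(* The Krull dimension *)
Definition has_dim (X : set proj) (d : nat) : Prop :=
  closed_chain X d /\ forall e, closed_chain X e -> (e <= d)%N.

(* The homogeneous ideal of X, as the ideal of its affine cone *)
Definition videal (X : set proj) : pred (mpoly n.+1 C) := fun f =>
  `[< forall v : nonzero_vec, X (\pi v) -> meval (\val v ord0) f = 0 >].

Lemma meval_scale d (f : mpoly n.+1 C) (t : C) (v : 'I_n.+1 -> C) :
  is_homog d f -> meval (fun i => t * v i) f = t ^+ d * meval v f.
Proof.
move=> /dhomogP fd; rewrite !mevalE mulr_sumr big_seq [RHS]big_seq.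
apply: eq_bigr => m /fd md.
under eq_bigr do rewrite exprMn.
rewrite big_split /= mulrCA; congr (_ * (_ * _)).
have <- : mdeg m = d by exact: md.
by rewrite mdegE expr_sum.
Qed.

Lemma vanishes_atE d (f : mpoly n.+1 C) (v : nonzero_vec) : is_homog d f ->
  vanishes_at f (\pi v) <-> meval (\val v ord0) f = 0.
Proof.
move=> fd; have /eqmodP/asboolP [c cE] := reprK (\pi_proj v).
have c0 : c != 0.
  apply/eqP => c0; have := set_mem (valP (repr (\pi_proj v))).
  by rewrite /nonzero_vec /= cE c0 scale0r eqxx.
rewrite /vanishes_at; have -> : hcoord (\pi_proj v) = fun i => c * \val v ord0 i.
  by apply/funext => i; rewrite /hcoord cE mxE.
rewrite (meval_scale _ _ fd); split => [/eqP|->]; last by rewrite mulr0.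
by rewrite mulf_eq0 expf_eq0 (negbTE c0) andbF => /eqP.
Qed.

Definition cone_poly (f : mpoly n.+1 C) (v : 'I_n.+1 -> C) : {poly C} :=
  \poly_(d < mmeasure mdeg f) meval v (pihomog mdeg d f).

Lemma cone_polyE f v t : (cone_poly f v).[t] = meval (fun i => t * v i) f.
Proof.
rewrite horner_poly [in RHS](pihomog_partitionE (leqnn (mmeasure mdeg f))).
rewrite raddf_sum; apply: eq_bigr => d _.
by rewrite mulrC -meval_scale //; exact: pihomogP.
Qed.

Lemma cone_poly0 f v d :
  cone_poly f v = 0 -> meval v (pihomog mdeg d f) = 0.
Proof.
move=> /(congr1 (fun p : {poly C} => p`_d)); rewrite coef_poly coef0.
case: ltnP => // fd _.
have -> : pihomog mdeg d f = 0; last by rewrite raddf0.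
rewrite [in LHS](pihomog_partitionE (leqnn (mmeasure mdeg f))) raddf_sum big1 //= => e _.
by rewrite (pihomog_ne0 (d := e)) ?pihomogP // ltn_eqF // (leq_trans _ fd).
Qed.

Lemma poly_nz_eq0 (p : {poly C}) : (forall t, t != 0 -> p.[t] = 0) -> p = 0.
Proof.
move=> p0; apply: (@roots_geq_poly_eq0 _ _ [seq i.+1%:R | i <- iota 0 (size p)]).
- by apply/allP => _ /mapP [i _ ->]; rewrite /root p0 // pnatr_eq0.
- rewrite map_inj_uniq ?iota_uniq // => i j /eqP.
  by rewrite eqr_nat => /eqP [].
- by rewrite size_map size_iota.
Qed.

Lemma videal_pihomog (X : set proj) f :
  f \in videal X <-> forall d p, X p -> vanishes_at (pihomog mdeg d f) p.
Proof.
have scale_in (t : C) (v : nonzero_vec) : t != 0 -> X (\pi v) ->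
    exists2 w : nonzero_vec, X (\pi w) & \val w = t *: \val v.
  move=> t0 Xv; have w0 : t *: \val v \in nonzero_vec.
    rewrite inE /nonzero_vec /= scaler_eq0 negb_or t0.
    exact: (set_mem (valP v)).
  pose w : nonzero_vec := SigSub w0; exists w => //.
  suff -> : \pi_proj w = \pi_proj v by [].
  by apply/eqmodP/asboolP; exists t.
split=> [/asboolP fI d p Xp|fX].
  rewrite -[p]reprK; apply/(vanishes_atE _ (pihomogP mdeg d f)).
  apply: cone_poly0; apply: poly_nz_eq0 => t t0.
  have [||w Xw wE] := scale_in t (repr p) => //; first by rewrite reprK.
  rewrite cone_polyE -[RHS](fI w Xw) wE.
  by congr meval; apply/funext => i; rewrite mxE.
apply/asboolP => v Xv.
rewrite [f](pihomog_partitionE (leqnn (mmeasure mdeg f))) raddf_sum big1 //= => d _.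
by apply/(vanishes_atE _ (pihomogP mdeg d f)); exact: fX.
Qed.

Lemma videal_prime (X : pvariety) : prime_idealr_closed (videal X).
Proof.
move=> f g fg.
pose Z h := [set p : proj | forall k, range (fun d => pihomog mdeg d h) k ->
  vanishes_at k p].
have Zc h : zclosed (Z h).
  exists (range (fun d => pihomog mdeg d h)); split => // _ [d _ <-].
  by exists d; exact: pihomogP.
have ZI h : X `<=` Z h -> h \in videal X.
  by move=> XZ; apply/videal_pihomog => d p /XZ; apply; exists d.
case: (pv_irreducible X) => _ /(_ (Z f) (Z g) (Zc f) (Zc g)).
case=> [p Xp||]; [|by move=> /ZI ->|by move=> /ZI ->; rewrite orbT].
suff : cone_poly f (hcoord p) * cone_poly g (hcoord p) = 0.
  move/eqP; rewrite mulf_eq0 => /orP [] /eqP h0; [left|right];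
  by move=> _ [d _ <-]; rewrite /vanishes_at cone_poly0.
apply: poly_nz_eq0 => t t0; rewrite hornerM !cone_polyE -mevalM.
rewrite -cone_polyE (_ : cone_poly _ _ = 0) ?horner0 //.
apply/polyP => d; rewrite coef_poly coef0; case: ifP => // _.
by move/videal_pihomog: fg => /(_ d p Xp).
Qed.

Lemma videal_idealr (X : pvariety) : idealr_closed (videal X).
Proof.
split.
- by apply/asboolP => v _; rewrite raddf0.
- apply/negP => /asboolP I1; case: (pv_irreducible X) => -[p Xp] _.
  have := I1 (repr p); rewrite reprK => /(_ Xp) /eqP.
  by rewrite rmorph1 oner_eq0.
- move=> a f g /asboolP fI /asboolP gI; apply/asboolP => v Xv.
  by rewrite mevalD mevalM fI // gI // mulr0 addr0.
Qed.

HB.instance Definition _ (X : pvariety) :=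
  isIdealr.Build (mpoly n.+1 C) (videal X) (videal_idealr X).
HB.instance Definition _ (X : pvariety) :=
  isPrimeIdealrClosed.Build (mpoly n.+1 C) (videal X) (@videal_prime X).

(** ** The homogeneous coordinate ring and the function field *)

Section FunctionField.
Variable X : pvariety.

Definition prime_videal : prime_idealr (mpoly n.+1 C) := videal X.

Definition coord_ring : Type := {ideal_quot prime_videal}.

HB.instance Definition _ := GRing.ComNzRing.on coord_ring.

Definition coord_unit : pred coord_ring := fun a => `[< exists b, b * a = 1 >].

Definition coord_inv (a : coord_ring) : coord_ring :=
  if pselect (exists b, b * a = 1) is left h then xget 0 [set b | b * a = 1]
  else a.

Lemma coord_mulV : {in coord_unit, left_inverse 1 coord_inv *%R}.
Proof.
move=> a /asboolP ua; rewrite /coord_inv; case: pselect => // -[b ba].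
by case: xgetP => [c _ //|/(_ b)].
Qed.

Lemma coord_unitP (a b : coord_ring) : b * a = 1 -> coord_unit a.
Proof. by move=> ba; apply/asboolP; exists b. Qed.

Lemma coord_inv_out : {in [predC coord_unit], coord_inv =1 id}.
Proof.
by move=> a /asboolP na; rewrite /coord_inv; case: pselect.
Qed.

HB.instance Definition _ := GRing.ComNzRing_hasMulInverse.Build coord_ring
  coord_mulV coord_unitP coord_inv_out.

Lemma coord_integral : GRing.integral_domain_axiom coord_ring.
Proof. by move=> a b; exact: (@Quotient.rquot_IdomainAxiom _ prime_videal). Qed.

HB.instance Definition _ :=
  GRing.ComUnitRing_isIntegral.Build coord_ring coord_integral.

Definition coord_proj (f : mpoly n.+1 C) : coord_ring := \pi_({ideal_quot prime_videal}) f.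

Definition coord_frac (f : mpoly n.+1 C) : {fraction coord_ring} :=
  FracField.tofrac (coord_proj f).

Lemma coord_frac_is_zmod_morphism : zmod_morphism coord_frac.
Proof. by move=> f g; rewrite /coord_frac /coord_proj !rmorphB. Qed.

Lemma coord_frac_is_monoid_morphism : monoid_morphism coord_frac.
Proof.
by split=> [|f g]; rewrite /coord_frac /coord_proj ?rmorph1 ?rmorphM.
Qed.

HB.instance Definition _ := GRing.isZmodMorphism.Build _ _ coord_frac
  coord_frac_is_zmod_morphism.
HB.instance Definition _ := GRing.isMonoidMorphism.Build _ _ coord_frac
  coord_frac_is_monoid_morphism.

Lemma coord_frac_eq0 f : (coord_frac f == 0) = (f \in videal X).
Proof.
rewrite /coord_frac tofrac_eq0 /coord_proj -[0](rmorph0 (\pi_({ideal_quot prime_videal}))).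
by rewrite -Quotient.idealrBE subr0.
Qed.

Lemma coord_frac_surj (h : {fraction coord_ring}) :
  exists f g, g \notin videal X /\ h = coord_frac f / coord_frac g.
Proof.
have [a [b [b0 ->]]] := fraction_surj h.
exists (repr a), (repr b); rewrite -coord_frac_eq0 /coord_frac /coord_proj !reprK.
by rewrite tofrac_eq0.
Qed.

(* The field of fractions of the homogeneous coordinate ring C[x_0..x_n] / I(X),
   sealed: it is used only through the map from C[x_0..x_n], with kernel I(X)
   and such that every element is a quotient of two values. *)
Fact cone_field_sig :
  {L : fieldType & {phi : {rmorphism mpoly n.+1 C -> L} |
    (forall f, (phi f == 0) = (f \in videal X)) /\
    (forall h, exists f g, g \notin videal X /\ h = phi f / phi g)}}.
Proof.
exists {fraction coord_ring}; exists coord_frac.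
by split; [exact: coord_frac_eq0 | exact: coord_frac_surj].
Qed.

Definition cone_field : fieldType := projT1 cone_field_sig.

Definition cone_ev : {rmorphism mpoly n.+1 C -> cone_field} :=
  sval (projT2 cone_field_sig).

Lemma cone_ev_eq0 f : (cone_ev f == 0) = (f \in videal X).
Proof. exact: (svalP (projT2 cone_field_sig)).1. Qed.

Lemma cone_field_frac h :
  exists f g, g \notin videal X /\ h = cone_ev f / cone_ev g.
Proof. exact: (svalP (projT2 cone_field_sig)).2. Qed.

(* f / g with f, g homogeneous of the same degree and g not identically 0 on X *)
Definition ratfun : pred cone_field := fun h =>
  `[< exists d f g, [/\ is_homog d f, is_homog d g, g \notin videal X &
        h = cone_ev f / cone_ev g] >].

Lemma is_homogM d e f g : is_homog d f -> is_homog e g -> is_homog (d + e) (f * g).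
Proof. exact: dhomogM. Qed.

Lemma ratfun_divring : divring_closed ratfun.
Proof.
split.
- apply/asboolP; exists 0%N, 1, 1; split; rewrite ?/is_homog ?dhomog1 //.
    exact: (negbT (idealr1 prime_videal)).
  by rewrite rmorph1 divr1.
- move=> _ _ /asboolP [d [f [g [fd gd gI ->]]]] /asboolP [e [k [l [ke le lI ->]]]].
  apply/asboolP; exists (d + e)%N, (f * l - k * g), (g * l); split.
  + rewrite /is_homog; apply: rpredB; first exact: dhomogM.
    by rewrite addnC; exact: dhomogM.
  + exact: is_homogM.
  + by rewrite (prime_idealrM prime_videal) negb_or gI.
  + rewrite -!cone_ev_eq0 in gI lI.
    by rewrite rmorphB !rmorphM; exact: (frac_sub (cone_ev f) (cone_ev k) gI lI).
- move=> _ _ /asboolP [d [f [g [fd gd gI ->]]]] /asboolP [e [k [l [ke le lI ->]]]].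
  apply/asboolP; have [kI|kI] := boolP (k \in videal X).
    exists 0%N, 0, 1; split; [exact: dhomog0|exact: dhomog1| |].
      exact: (negbT (idealr1 prime_videal)).
    move: kI; rewrite -cone_ev_eq0 => /eqP kI.
    by rewrite kI mul0r invr0 mulr0 [cone_ev 0]rmorph0 mul0r.
  exists (d + e)%N, (f * l), (g * k); split.
  + exact: is_homogM.
  + exact: is_homogM.
  + by rewrite (prime_idealrM prime_videal) negb_or gI.
  + by rewrite !rmorphM; exact: (frac_div (cone_ev f) (cone_ev g) (cone_ev k) (cone_ev l)).
Qed.

HB.instance Definition _ := GRing.isDivringClosed.Build cone_field
  ratfun ratfun_divring.

Definition funfield : Type := {h : cone_field | ratfun h}.

HB.instance Definition _ := [isSub for (@sval _ _ : funfield -> _)].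
HB.instance Definition _ := [Choice of funfield by <:].
HB.instance Definition _ := [SubChoice_isSubComUnitRing of funfield by <:].
HB.instance Definition _ := [SubComUnitRing_isSubIntegralDomain of funfield by <:].
HB.instance Definition _ := [SubIntegralDomain_isSubField of funfield by <:].

End FunctionField.

End ProjectiveSpace.

Arguments hcoord {C n} p i.

(** * Local rings and divisors *)

Section Divisors.
Variables (C : numClosedFieldType) (n : nat) (X : pvariety C n).

Local Notation V := (pv_set X).

Implicit Types (p q : proj C n) (h : funfield X) (D : proj C n -> funfield X).

Definition is_frac h (f g : mpoly n.+1 C) : Prop :=
  exists d, [/\ is_homog d f, is_homog d g & \val h = cone_ev X f / cone_ev X g].

Definition regular_at p h : Prop :=
  exists f g, is_frac h f g /\ ~ vanishes_at g p.

Definition has_value p h (c : C) : Prop :=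
  exists f g, [/\ is_frac h f g, ~ vanishes_at g p &
    c = meval (hcoord p) f / meval (hcoord p) g].

Definition unit_at p h : Prop :=
  [/\ h != 0, regular_at p h & regular_at p h^-1].

(* A Cartier divisor, as a global section of the sheaf K^* / O^*: for p in X,
   D p is a local equation of the divisor at p, defined up to a unit of the
   local ring at p.  The values of D outside X are irrelevant.  On a smooth X
   these are the same as Weil divisors. *)
Definition is_divisor D : Prop :=
  (forall p, V p -> D p != 0) /\
  forall p, V p -> exists A, [/\ zclosed A, ~ A p &
    forall q, V q -> ~ A q -> unit_at q (D q / D p)].

(* The global sections of O_X(D), which is generated at p by (D p)^-1 *)
Definition is_section D h : Prop := forall p, V p -> regular_at p (h * D p).

Definition globally_generated D : Prop :=
  forall p, V p -> exists h, is_section D h /\ unit_at p (h * D p).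

(** ** Ample divisors *)

(* The value at the homogeneous coordinates s of a polynomial in N + 1
   variables, in the field of fractions of the coordinate ring of X *)
Definition poly_at N (s : 'I_N.+1 -> funfield X) (a : mpoly N.+1 C) :
    cone_field X :=
  mmap (fun c => cone_ev X (mpolyC n.+1 c)) (fun i => \val (s i)) a.

(* phi restricts to the map X -> P^N with homogeneous coordinates
   p |-> [s_0(p) : ... : s_N(p)], where the section s_i of O_X(D) is
   trivialised as s_i * D p near p; in particular the s_i have no common zero. *)
Definition map_of_sections D N (s : 'I_N.+1 -> funfield X)
    (phi : proj C n -> proj C N) : Prop :=
  forall p, V p -> exists2 c : C, c != 0 &
    forall i, has_value p (s i * D p) (c * hcoord (phi p) i).

(* A homeomorphism of X onto a closed subset of P^N, such that the comorphism
   O_{P^N, phi p} -> O_{X, p}, a / b |-> a(s) / b(s), is surjective for all p.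
   Continuity is automatic for a map given by sections. *)
Definition closed_immersion N (s : 'I_N.+1 -> funfield X)
    (phi : proj C n -> proj C N) : Prop :=
  [/\ forall p q, V p -> V q -> phi p = phi q -> p = q,
      forall A : set (proj C n), zclosed A -> A `<=` V -> zclosed (phi @` A) &
      forall p h, V p -> regular_at p h -> exists e (a b : mpoly N.+1 C),
        [/\ is_homog e a, is_homog e b, ~ vanishes_at b (phi p) &
            \val h = poly_at s a / poly_at s b]].

Definition very_ample D : Prop :=
  exists N (s : 'I_N.+1 -> funfield X) (phi : proj C n -> proj C N),
    [/\ forall i, is_section D (s i), map_of_sections D s phi &
        closed_immersion s phi].

Definition ample D : Prop :=
  is_divisor D /\ exists2 m, (0 < m)%N & very_ample (fun p => D p ^+ m).

(** ** Smoothness and canonical divisors *)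

(* The Jacobian criterion at p, for homogeneous generators F of I(X) *)
Definition nonsingular_at (d : nat) p : Prop :=
  exists k (F : 'I_k -> mpoly n.+1 C),
    [/\ forall i, exists e, is_homog e (F i),
        forall f, f \in videal X <-> exists c : 'I_k -> mpoly n.+1 C,
          f = \sum_i c i * F i &
        (\rank (\matrix_(i < k, j < n.+1) meval (hcoord p) (mderiv j (F i)))
          + d)%N = n].

Definition smooth : Prop :=
  exists2 d, has_dim V d & forall p, V p -> nonsingular_at d p.

(* With d the dimension of X, a regular system of parameters at p *)
Definition local_parameters (d : nat) p (u : 'I_d -> funfield X) : Prop :=
  (forall i, has_value p (u i) 0) /\
  forall h, has_value p h 0 -> exists2 c : 'I_d -> funfield X,
    forall i, regular_at p (c i) & h = \sum_i c i * u i.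

Record is_derivation (del : funfield X -> funfield X) : Prop := IsDerivation {
  derivD : forall h k, del (h + k) = del h + del k;
  derivM : forall h k, del (h * k) = del h * k + h * del k;
  deriv_const : forall h (c : C), \val h = cone_ev X (mpolyC n.+1 c) -> del h = 0
}.

(* D is the divisor of the nonzero rational d-form g dz_1 /\ ... /\ dz_d, where
   d = dim X.  If u_1, ..., u_d are local parameters at p, then du_1, ..., du_d
   is a basis of the 1-forms at p, the dual derivations del_j = d/du_j are
   characterised by del_j u_i = delta_ij, and
   dz_1 /\ ... /\ dz_d = det (del_j z_i) du_1 /\ ... /\ du_d. *)
Definition canonical_divisor D : Prop :=
  is_divisor D /\ exists d (g : funfield X) (z : 'I_d -> funfield X),
    has_dim V d /\
    forall p, V p -> exists (u : 'I_d -> funfield X)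
        (del : 'I_d -> funfield X -> funfield X),
      [/\ local_parameters p u, forall j, is_derivation (del j),
          forall i j, del j (u i) = (i == j)%:R &
          unit_at p (D p / (g * \det (\matrix_(i < d, j < d) del j (z i))))].

(** ** The convex Fujita number *)

Definition fujita_bound (m : nat) : Prop :=
  forall s, (m <= s)%N -> forall L : 'I_s -> proj C n -> funfield X,
    (forall i, ample (L i)) -> forall K, canonical_divisor K ->
    globally_generated (fun p => K p * \prod_(i < s) L i p).

(* None stands for infinity *)
Definition Fu : option nat :=
  if pselect (exists m, `[< fujita_bound m >]) is left h then Some (ex_minn h)
  else None.

End Divisors.

(* Main.v *)
From mathcomp Require Import all_boot all_order all_algebra.
From mathcomp Require Import -(notations) mpoly.
From mathcomp Require Import ring lra complex.
From mathcomp Require Import all_classical all_reals all_analysis.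
Require Import Defs.

Set Implicit Arguments.
Unset Strict Implicit.
Unset Printing Implicit Defensive.

Import Order.TTheory GRing.Theory Num.Theory.
Import numFieldNormedType.Exports.

Local Open Scope ring_scope.
Local Open Scope classical_set_scope.
Local Open Scope quotient_scope.

(** The two varieties are a point, P^0, and the projective line, P^1; both are
simply connected, and Fu is 0 for the point and not 0 for the line.

On a point every nonzero local equation is a unit, so every divisor is globally
generated and 0 is a Fujita bound ([Fu_point]).

On P^1, with affine coordinate t = x0/x1, the divisor of the 1-form dt is
canonical ([canonical_Kline]): its local equation is 1 away from the point at
infinity, and t^2 there. It has no nonzero section ([Kline_section0]). Write
such a section as f/g, with f and g forms of the same degree. At a zero of g
regularity forces f to vanish as well, so a linear factor cancels; in degree 0
the double pole that t^2 introduces at infinity forces f = 0. Hence K alone is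
not globally generated, and 0 is not a Fujita bound ([Fu_line]); no ample
divisor on P^1 is needed. The algebra rests on [homog_root_dvd]: a binary form
that vanishes at a point is divisible by the linear form of that point. It also
gives the dimension of P^1 and its local parameters.

P^1 is simply connected ([loops_homotopic_line]). A loop lifts to a path
(g0, g1) in C^2 minus the origin ([lift_path]). For a linear form
x1 - c x0 that does not vanish at the base point, its value h = g1 - c g0 along
the lift can be moved slightly, with fixed ends, to a function k without zeros
([perturb_nonzero]); when the move is smaller than |h| at the zeros of g0, the
segment between (g0, h) and (g0, k) avoids the origin. The moved loop lies in
the affine line where the linear form does not vanish, and contracts there along
segments. Both the lifting and the
perturbation are built on short intervals and concatenated ([interval_ind]). *)

(** * Forms and their zeros *)

(** Uniqueness of the base-[B] digits *)
Lemma digits_inj (B n : nat) (a b : 'I_n -> nat) :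
  (forall i, (a i < B)%N) -> (forall i, (b i < B)%N) ->
  (\sum_i a i * B ^ i = \sum_i b i * B ^ i)%N -> a =1 b.
Proof.
elim: n a b => [a b _ _ _ []//|n IH] a b aB bB.
have B0 : (0 < B)%N by exact: leq_ltn_trans (aB ord0).
have split_digit (c : 'I_n.+1 -> nat) : (\sum_i c i * B ^ i =
    (\sum_(i < n) c (lift ord0 i) * B ^ i) * B + c ord0)%N.
  rewrite big_ord_recl /= expn0 muln1 addnC big_distrl /=; congr (_ + _)%N.
  by apply: eq_bigr => i _; rewrite -mulnA -expnSr.
rewrite !split_digit => e.
have e0 : a ord0 = b ord0.
  by have := congr1 (modn^~ B) e; rewrite /= !modnMDl !modn_small.
move: e; rewrite e0 => /addIn/eqP; rewrite eqn_pmul2r // => /eqP /IH e i.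
by case: (unliftP ord0 i) => [j|] ->; rewrite ?e0 // e.
Qed.

(** Kronecker's substitution [x_i = t ^ ((d + 1) ^ i)] separates the monomials of
degree [d], so a form without nonzero values is zero. *)
Lemma homog_eq0 (F : numClosedFieldType) n d (f : mpoly n.+1 F) : is_homog d f ->
  (forall v : 'I_n.+1 -> F, (exists i, v i != 0) -> meval v f = 0) -> f = 0.
Proof.
move=> fd f0.
pose k (m : multinom n.+1) := (\sum_i m i * d.+1 ^ i)%N.
pose P : {poly F} := \sum_(m <- msupp f) mcoeff m f *: 'X^(k m).
have P0 : P = 0.
  apply: poly_nz_eq0 => t t0; rewrite horner_sum.
  rewrite -[RHS](f0 (fun i => t ^+ (d.+1 ^ i))); last by exists ord0; rewrite expf_neq0.
  rewrite mevalE; apply: eq_bigr => m _.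
  rewrite hornerZ hornerXn expr_sum; congr (_ * _); apply: eq_bigr => i _.
  by rewrite -exprM mulnC.
have kI : {in msupp f &, injective k}.
  have small m i : m \in msupp f -> (m i < d.+1)%N.
    move/dhomogP: fd => /[apply] => md.
    have <- : mdeg m = d by exact: md.
    by rewrite ltnS mdegE (bigD1 i) //= leq_addr.
  by move=> m m' mf mf' /digits_inj e; apply/mnmP; apply: e => i; exact: small.
apply/mpolyP => m; rewrite mcoeff0; apply/eqP/negP => /negP; rewrite -mcoeff_msupp => mf.
have : P`_(k m) = 0 by rewrite P0 coef0.
rewrite coef_sum (bigD1_seq m) ?msupp_uniq //= big_seq_cond big1 => [|m' /andP[m'f m'm]].
  by rewrite coefZ coefXn eqxx mulr1 addr0 => /eqP; apply/negP; rewrite -mcoeff_msupp.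
rewrite coefZ coefXn; case: eqP => [/(kI _ _ mf m'f) e|]; last by rewrite mulr0.
by rewrite e eqxx in m'm.
Qed.

Section BinaryForms.
Variable C : numClosedFieldType.

Local Notation x0 := (mpolyX C (mnm1 (ord0 : 'I_2))).
Local Notation x1 := (mpolyX C (mnm1 (ord_max : 'I_2))).

Implicit Types (f g : mpoly 2 C) (v w : 'I_2 -> C) (d : nat).

Lemma ord2P (i : 'I_2) : i = ord0 \/ i = ord_max.
Proof. by case: i => -[|[|]] //= h; [left|right]; exact: val_inj. Qed.

Lemma homog2_mdeg d f (m : multinom 2) : is_homog d f -> m \in msupp f ->
  (m ord0 + m ord_max)%N = d.
Proof.
move=> /dhomogP fd mf; have <- : mdeg m = d by exact: fd.
by rewrite mdegE big_ord_recl big_ord1; congr (_ + m _)%N; apply: val_inj.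
Qed.

Lemma mpoly2E f :
  f = \sum_(m <- msupp f) mcoeff m f *: (x0 ^+ m ord0 * x1 ^+ m ord_max).
Proof.
rewrite {1}[f]mpolyE; apply: eq_bigr => m _; congr (_ *: _).
rewrite mpolyXE_id big_ord_recl big_ord1; congr (_ * _).
by have -> : lift ord0 ord0 = ord_max :> 'I_2 by apply: val_inj.
Qed.

Lemma meval2E v f :
  meval v f = \sum_(m <- msupp f) mcoeff m f * (v ord0 ^+ m ord0 * v ord_max ^+ m ord_max).
Proof.
rewrite mevalE; apply: eq_bigr => m _; rewrite big_ord_recl big_ord1.
by have -> : lift ord0 ord0 = ord_max :> 'I_2 by apply: val_inj.
Qed.

Lemma homogX (n : nat) (i : 'I_n.+1) : is_homog 1 (mpolyX C (mnm1 i)).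
Proof. by rewrite /is_homog dhomogX; apply/eqP; exact: mdeg1. Qed.

(** The linear form whose only zero in P^1 is the point [v] *)
Definition line_form (v : 'I_2 -> C) : mpoly 2 C := v ord_max *: x0 - v ord0 *: x1.

Lemma homog_line_form v : is_homog 1 (line_form v).
Proof. by apply: rpredB; apply: dhomogZ; exact: homogX. Qed.

Lemma meval_line_form w v :
  meval w (line_form v) = v ord_max * w ord0 - v ord0 * w ord_max.
Proof. by rewrite mevalB !mevalZ !mevalXU. Qed.

Lemma is_homogXn d f k : is_homog d f -> is_homog (k * d) (f ^+ k).
Proof. by move=> fd; rewrite mulnC; exact: dhomogMn. Qed.

(** [y ^ i] and [z ^ i] agree modulo [y - z]. For [i = 0] the quotient is zero,
which has every degree. *)
Lemma homog_subX (y z : mpoly 2 C) i j k : is_homog 1 y -> is_homog 1 z ->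
  is_homog 1 k -> 
  exists2 q, is_homog (i + j).-1 q & y ^+ i * k ^+ j = z ^+ i * k ^+ j + (y - z) * q.
Proof.
move=> hy hz hk.
exists ((\sum_(l < i) y ^+ (i.-1 - l) * z ^+ l) * k ^+ j); last first.
  by rewrite mulrA -subrXX mulrBl addrC subrK.
case: i => [|i]; first by rewrite big_ord0 mul0r /is_homog dhomog0.
rewrite addSn /=; apply: is_homogM; last by rewrite -[j in is_homog j _]muln1; exact: is_homogXn.
apply: rpred_sum => l _; have li : (l <= i)%N by rewrite -ltnS ltn_ord.
rewrite -/(is_homog i _) -[X in is_homog X _](subnK li).
by apply: is_homogM; rewrite -[X in is_homog X _]muln1; exact: is_homogXn.
Qed.

(** A form that vanishes at [v] is divisible by the linear form of [v]: if
[v k != 0], then modulo [line_form v] each monomial is, up to the scalar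
[v k ^ d], its value at [v] times [x_k ^ d]. In degree 0 the quotient is zero. *)
Lemma homog_root_dvd d f v : (exists i, v i != 0) -> is_homog d f -> meval v f = 0 ->
  exists2 g, is_homog d.-1 g & f = line_form v * g.
Proof.
pose S f := exists2 g, is_homog d.-1 g & f = line_form v * g.
have S0 : S 0 by exists 0; rewrite ?mulr0 // /is_homog dhomog0.
have SD f1 f2 : S f1 -> S f2 -> S (f1 + f2).
  by move=> [g1 h1 ->] [g2 h2 ->]; exists (g1 + g2); rewrite ?mulrDr //; exact: rpredD.
have SZ c f1 : S f1 -> S (c *: f1).
  by move=> [g1 h1 ->]; exists (c *: g1); rewrite ?scalerAr //; exact: dhomogZ.
move=> vn0 fd fv.
suff [k vk mono] : exists2 k : 'I_2, v k != 0 & forall m, m \in msupp f ->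
    S (v k ^+ d *: (x0 ^+ m ord0 * x1 ^+ m ord_max) -
      (v ord0 ^+ m ord0 * v ord_max ^+ m ord_max) *: mpolyX C (mnm1 k) ^+ d).
  rewrite (_ : f = (v k ^+ d)^-1 *:
    (v k ^+ d *: f - meval v f *: mpolyX C (mnm1 k) ^+ d)); last first.
    by rewrite fv scale0r subr0 scalerA mulVf ?scale1r // expf_neq0.
  apply: (SZ); rewrite meval2E {1}(mpoly2E f) scaler_suml scaler_sumr -sumrB big_seq.
  apply: (big_ind S) => // m /mono /(SZ (mcoeff m f)).
  by rewrite scalerBr !scalerA mulrC.
have [v0|v0] := eqVneq (v ord_max) 0; last first.
  exists ord_max => // m mf; have dE := homog2_mdeg fd mf.
  have [||q qh qE] := homog_subX (y := v ord_max *: x0) (z := v ord0 *: x1)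
    (m ord0) (m ord_max) _ _ (homogX ord_max).
  - exact/dhomogZ/homogX.
  - exact/dhomogZ/homogX.
  exists (v ord_max ^+ m ord_max *: q); first by apply: dhomogZ; rewrite -dE.
  rewrite -scalerAr -/(line_form v); move/eqP: qE; rewrite addrC -subr_eq => /eqP <-.
  rewrite -dE !exprZn scalerBr -!scalerAl !scalerA -!exprD.
  by rewrite [(m ord_max + m ord0)%N]addnC [v ord_max ^+ _ * v ord0 ^+ _]mulrC.
have v1 : v ord0 != 0.
  by case: vn0 => i; case: (ord2P i) => -> //; rewrite v0 eqxx.
exists ord0 => // m mf; have dE := homog2_mdeg fd mf.
have [||q qh qE] := homog_subX (y := v ord0 *: x1) (z := v ord_max *: x0)
  (m ord_max) (m ord0) _ _ (homogX ord0).
- exact/dhomogZ/homogX.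
- exact/dhomogZ/homogX.
exists (- (v ord0 ^+ m ord0 *: q)).
  by rewrite /is_homog dhomogN; apply: dhomogZ; rewrite -dE addnC.
rewrite mulrN -mulNr opprB -scalerAr; move/eqP: qE; rewrite addrC -subr_eq => /eqP <-.
rewrite -dE !exprZn scalerBr -!scalerAl !scalerA -!exprD.
by rewrite [(m ord_max + m ord0)%N]addnC [x1 ^+ _ * x0 ^+ _]mulrC.
Qed.

Lemma homog0_const (n : nat) (f : mpoly n.+1 C) :
  is_homog 0 f -> f = mpolyC n.+1 (mcoeff (@mnm0 _) f).
Proof.
move=> f0; apply/mpolyP => m; rewrite mcoeffC.
have [->|m0] := eqVneq m (@mnm0 _); rewrite ?mulr1 ?mulr0 //.
by apply: (dhomog_nemf_coeff f0); rewrite mdeg_eq0.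
Qed.

(** Dehomogenize at [x1 = 1]: a nonconstant polynomial has a root, and a constant
one means that the form vanishes at the point at infinity. *)
Lemma homog_root d f : (0 < d)%N -> is_homog d f ->
  exists2 v : 'I_2 -> C, (exists i, v i != 0) & meval v f = 0.
Proof.
move=> d0 fd.
pose P : {poly C} := \sum_(m <- msupp f) mcoeff m f *: 'X^(m ord0).
pose pt (a b : C) : 'I_2 -> C := fun i => if i == ord0 then a else b.
have PE t : P.[t] = meval (pt t 1) f.
  rewrite horner_sum meval2E; apply: eq_bigr => m _.
  by rewrite /pt /= expr1n mulr1 hornerZ hornerXn.
have [/closed_rootP [t /eqP Pt]|] := boolP (size P != 1%N); last first.
  rewrite negbK => /eqP sP; exists (pt 1 0); first by exists ord0; rewrite /pt /= oner_eq0.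
  have Pd : P`_d = 0 by rewrite nth_default // sP.
  rewrite -[RHS]Pd coef_sum meval2E big_seq [RHS]big_seq; apply: eq_bigr => m /(homog2_mdeg fd) dE.
  rewrite coefZ coefXn /pt /= expr1n mul1r expr0n -dE.
  by rewrite -[X in (_ + _ == X)%N]addn0 eqn_add2l.
by exists (pt t 1); [exists ord_max; rewrite /pt /= oner_eq0|rewrite -PE].
Qed.

End BinaryForms.

(** * Projective space as a variety *)

Section ProjectiveSpaceVariety.
Variables (C : numClosedFieldType) (n : nat).
Implicit Types (p q : proj C n) (f : mpoly n.+1 C).

Lemma hcoord_neq0 p : exists i, hcoord p i != 0.
Proof.
have : \val (repr p) != 0 by exact: (set_mem (valP (repr p))).
by case/rV0Pn => i; exists i.
Qed.

Lemma proj_point (v : 'I_n.+1 -> C) : (exists i, v i != 0) ->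
  exists p, forall d f, is_homog d f -> vanishes_at f p <-> meval v f = 0.
Proof.
move=> vn0; have w0 : (\row_i v i) \in @nonzero_vec C n.
  by rewrite inE; case: vn0 => i vi; apply/rV0Pn; exists i; rewrite mxE.
pose w : @nonzero_vec C n := SigSub w0.
exists (\pi w) => d f fd; rewrite (vanishes_atE w fd).
by have -> : \val w ord0 = v by apply/funext => i; rewrite mxE.
Qed.

Lemma homog_vanish_eq0 d f : is_homog d f -> (forall p, vanishes_at f p) -> f = 0.
Proof.
move=> fd f0; apply: (homog_eq0 fd) => v /proj_point [p pP].
exact/(pP d f fd).
Qed.

Lemma zclosed_zeros d f : is_homog d f -> zclosed [set p | vanishes_at f p].
Proof.
move=> fd; exists [set f]; split; first by move=> _ ->; exists d.
by apply/seteqP; split => p /= h; [move=> _ ->|exact: h].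
Qed.

Lemma zclosedT : zclosed [set: proj C n].
Proof. by exists set0; split => //; apply/esym/seteqP; split => // p _ f []. Qed.

Lemma zclosed_proper (B : set (proj C n)) : zclosed B -> ~ ([set: proj C n] `<=` B) ->
  exists d f, [/\ is_homog d f, f != 0 & forall p, B p -> vanishes_at f p].
Proof.
move=> [F [Fh ->]] /existsNP [p /not_implyP [_ /existsNP [f /not_implyP [Ff fp]]]].
have [d fd] := Fh _ Ff; exists d, f; split => // [|q]; last exact.
by apply: contra_notN fp => /eqP ->; rewrite /vanishes_at raddf0.
Qed.

Lemma zirreducibleT : zirreducible [set: proj C n].
Proof.
split; first by have [|p _] := @proj_point (fun=> 1); [exists ord0; exact: oner_neq0|exists p].
move=> B1 B2 /zclosed_proper c1 /zclosed_proper c2 B12; apply: contrapT.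
move=> /not_orP [/c1 [d [f [fd f0 fB]]] /c2 [e [g [ge g0 gB]]]].
suff : f * g = 0 by move/eqP; rewrite mulf_eq0 (negbTE f0) (negbTE g0).
apply: (homog_vanish_eq0 (is_homogM fd ge)) => p; rewrite /vanishes_at mevalM.
by case: (B12 p) => // [/fB|/gB] ->; rewrite ?mul0r ?mulr0.
Qed.

(** P^n, as a closed subset of itself *)
Definition projective_space : pvariety C n := PVariety zclosedT zirreducibleT.

Lemma videal_projective_space f : (f \in videal projective_space) = (f == 0).
Proof.
apply/idP/eqP => [/videal_pihomog f0|->]; last first.
  by apply/videal_pihomog => d p _; rewrite raddf0 /vanishes_at raddf0.
rewrite (pihomog_partitionE (leqnn (mmeasure mdeg f))) big1 // => d _.
by apply: (homog_vanish_eq0 (pihomogP mdeg d f)) => p; exact: f0.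
Qed.

Lemma nonsingular_projective_space p : nonsingular_at projective_space n p.
Proof.
exists 0%N, (fun=> 0); split => [[]//|f|]; last by rewrite flatmx0 mxrank0.
split => [|[c ->]]; last by rewrite big_ord0 videal_projective_space.
by rewrite videal_projective_space => /eqP ->; exists (fun=> 0); rewrite big_ord0.
Qed.

Lemma zirreducible_zconnected (A : set (proj C n)) : zirreducible A -> zconnected A.
Proof. by move=> [A0 AI]; split => // B1 B2 c1 c2 /(AI _ _ c1 c2). Qed.

End ProjectiveSpaceVariety.

(** * The point *)

Section ProjectivePoint.
Variable C : numClosedFieldType.

Lemma proj0_unique (p q : proj C 0) : p = q.
Proof.
rewrite -[p]reprK -[q]reprK; apply/eqmodP/asboolP.
have [i qi] := hcoord_neq0 q; have [j pj] := hcoord_neq0 p.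
exists (hcoord p ord0 / hcoord q ord0); apply/rowP => k; rewrite mxE !ord1.
by rewrite ord1 in qi; rewrite divfK.
Qed.

Lemma has_dim_point : has_dim [set: proj C 0] 0.
Proof.
split.
  exists (fun=> setT); split => // i _.
  by split; [exact: zclosedT|split => //; exact: zirreducibleT].
move=> [//|e] [Z [Zi Zlt]]; have [] := Zlt 0%N isT.
have [] := Zi 0%N isT; move=> _ [[[p Zp] _] _] _ []; move=> q _.
by rewrite (proj0_unique q p).
Qed.

Lemma smooth_point : smooth (projective_space C 0).
Proof. by exists 0%N; [exact: has_dim_point|move=> p _; exact: nonsingular_projective_space]. Qed.

Lemma globally_generated_point (D : proj C 0 -> funfield (projective_space C 0)) :
  (forall p, D p != 0) -> globally_generated D.
Proof.
move=> D0 p _; exists (D p)^-1.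
have reg1 q : regular_at q (1 : funfield (projective_space C 0)).
  exists 1, 1; split.
    exists 0%N; split; rewrite ?/is_homog ?dhomog1 //.
    by rewrite !rmorph1 divr1.
  by rewrite /vanishes_at rmorph1; apply/eqP; exact: oner_neq0.
split => [q _|]; first by rewrite (proj0_unique q p) mulVf.
by rewrite mulVf //; split; rewrite ?invr1 ?oner_neq0.
Qed.

Lemma fujita_bound_point : fujita_bound (projective_space C 0) 0.
Proof.
move=> s _ L aL K [[K0 _] _]; apply: globally_generated_point => p.
rewrite mulf_neq0 ?K0 //; apply/prodf_neq0 => i _.
by have [[L0 _] _] := aL i; exact: L0.
Qed.

Lemma Fu_point : Fu (projective_space C 0) = Some 0%N.
Proof.
rewrite /Fu; case: pselect => [h|[]]; last first.
  by exists 0%N; apply/asboolP; exact: fujita_bound_point.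
congr Some; case: ex_minnP => m _ /(_ 0%N); rewrite leqn0 => mmin.
by apply/eqP/mmin/asboolP; exact: fujita_bound_point.
Qed.

End ProjectivePoint.

(** * The projective line *)

Section ProjectiveLine.
Variable C : numClosedFieldType.

Local Notation P1 := (projective_space C 1).
Local Notation K := (cone_field P1).
Local Notation ev := (cone_ev P1).
Local Notation x0 := (mpolyX C (mnm1 (ord0 : 'I_2))).
Local Notation x1 := (mpolyX C (mnm1 (ord_max : 'I_2))).

Implicit Types (f g : mpoly 2 C) (p q : proj C 1) (h : funfield P1).

Lemma proj1_eq p q :
  hcoord p ord_max * hcoord q ord0 = hcoord p ord0 * hcoord q ord_max -> p = q.
Proof.
move=> e; rewrite -[p]reprK -[q]reprK; apply/eqmodP/asboolP.
have [i qi] := hcoord_neq0 q.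
exists (hcoord p i / hcoord q i); apply/rowP => k; rewrite mxE.
apply: (mulIf qi); rewrite mulrAC divfK //.
rewrite -!/(hcoord _ _); case: (ord2P i) => ->; case: (ord2P k) => -> //; exact/esym.
Qed.

Lemma zclosed_point p : zclosed [set p].
Proof.
rewrite (_ : [set p] = [set q | vanishes_at (line_form (hcoord p)) q]).
  exact: zclosed_zeros (homog_line_form _).
apply/seteqP; split => q; rewrite /= /vanishes_at meval_line_form.
  by move=> ->; rewrite mulrC subrr.
by move/eqP; rewrite subr_eq0 => /eqP/proj1_eq.
Qed.

Lemma homog_vanish_dvd d f p : is_homog d f -> vanishes_at f p ->
  exists2 g, is_homog d.-1 g & f = line_form (hcoord p) * g.
Proof. by move=> fd fp; apply: homog_root_dvd => //; exact: hcoord_neq0. Qed.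

Lemma vanishes_at_const f p : is_homog 0 f -> vanishes_at f p -> f = 0.
Proof.
move=> /homog0_const ->; rewrite /vanishes_at mevalC => ->.
exact: mpolyC0.
Qed.

(** A proper irreducible closed subset of P^1 is a point: split off one linear
factor of an equation [f] at a time. *)
Lemma zirreducible_zeros d f (A : set (proj C 1)) : is_homog d f -> f != 0 -> zirreducible A ->
  (forall p, A p -> vanishes_at f p) -> exists p, A `<=` [set p].
Proof.
elim: d f => [|d IH] f fd f0 [[p Ap] AI] Af.
  by have := vanishes_at_const fd (Af p Ap) => fE; rewrite fE eqxx in f0.
have [g gd fE] := homog_vanish_dvd fd (Af p Ap).
have [||||] := AI [set p] [set q | vanishes_at g q].
- exact: zclosed_point.
- exact: zclosed_zeros gd.
- move=> q /Af; rewrite fE /vanishes_at mevalM => /eqP; rewrite mulf_eq0.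
  move=> /orP[|/eqP]; last by right.
  by rewrite meval_line_form subr_eq0 => /eqP/proj1_eq; left.
- by exists p.
- apply: IH gd _ _; last by split => //; exists p.
  by apply: contraNneq f0 => g0; rewrite fE g0 mulr0.
Qed.

Lemma has_dim_line : has_dim [set: proj C 1] 1.
Proof.
split.
  have [p _] : [set: proj C 1] !=set0 by have [] := @zirreducibleT C 1.
  exists (fun i : nat => if i == 0%N then [set p] else [set: proj C 1]); split => [[|i] _|[|//] _].
  - split; first exact: zclosed_point.
    by split => //; split; [exists p|move=> B1 B2 _ _ /(_ p erefl)[h|h]; [left|right] => _ ->].
  - by split; [exact: zclosedT|split => //; exact: zirreducibleT].
  - split => // Tp.
    have l0 : line_form (hcoord p) = 0.
      apply: (homog_vanish_eq0 (homog_line_form _)) => q.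
      by rewrite (Tp q I) /vanishes_at meval_line_form mulrC subrr.
    have [i pi] := hcoord_neq0 p.
    pose w := fun j : 'I_2 => if j == i then 0 else 1 : C.
    have := meval_line_form w (hcoord p); rewrite l0 meval0 /w.
    by case: (ord2P i) pi => -> pi /esym/eqP;
      rewrite /= !(mulr0, mulr1, subr0, sub0r, oppr_eq0) (negbTE pi).
move=> e [Z [Zi Zlt]]; rewrite leqNgt; apply/negP => e2.
have [Z0c [[[p Z0p] _] _]] := Zi 0%N isT.
have [Z1c [Z1I _]] := Zi 1%N (ltnW e2).
have [Z01 nZ10] := Zlt 0%N (ltnW e2); have [_ nZ21] := Zlt 1%N e2.
have [|d [f [fd f0 fZ]]] := zclosed_proper Z1c.
  by move=> TZ; apply: nZ21 => q _; exact: TZ.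
have [q qP] := zirreducible_zeros fd f0 Z1I fZ.
by apply: nZ10 => r /qP ->; rewrite -(qP _ (Z01 _ Z0p)).
Qed.

Lemma smooth_line : smooth P1.
Proof. by exists 1%N; [exact: has_dim_line|move=> p _; exact: nonsingular_projective_space]. Qed.

Lemma ev_eq0 f : (ev f == 0) = (f == 0).
Proof. by rewrite cone_ev_eq0 videal_projective_space. Qed.

Lemma ev_inj : injective ev.
Proof. by move=> f g /eqP; rewrite -subr_eq0 -rmorphB ev_eq0 subr_eq0 => /eqP. Qed.

(** The rational function [f / g]; it is 0 when [f / g] is not a quotient of forms
of the same degree. *)
Definition ratio f g : funfield P1 := insubd 0 (ev f / ev g).

Lemma val_ratio d f g : is_homog d f -> is_homog d g -> g != 0 ->
  \val (ratio f g) = ev f / ev g.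
Proof.
move=> fd gd g0; rewrite /ratio insubdK // unfold_in; apply/asboolP.
by exists d, f, g; split => //; rewrite videal_projective_space.
Qed.

Lemma funfield_frac h : exists d f g,
  [/\ is_homog d f, is_homog d g, g != 0 & \val h = ev f / ev g].
Proof.
have /asboolP [d [f [g [fd gd]]]] := valP h.
by rewrite videal_projective_space => g0 hE; exists d, f, g.
Qed.

(** The derivation [x1 d/dx0] preserves degrees, and induces [d/dt] on the
functions of [t = x0 / x1]. *)
Definition der f : mpoly 2 C := x1 * mderiv ord0 f.

Lemma derD f g : der (f + g) = der f + der g.
Proof. by rewrite /der mderivD mulrDr. Qed.

Lemma derM f g : der (f * g) = der f * g + f * der g.
Proof. by rewrite /der mderivM; ring. Qed.

Lemma derC c : der (mpolyC 2 c) = 0.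
Proof. by rewrite /der mderivC mulr0. Qed.

Lemma der_x0 : der x0 = x1.
Proof.
rewrite /der mderivX mnm1E eqxx scale1r.
have -> : mnm_sub (mnm1 ord0) (mnm1 ord0) = mnm0 :> multinom 2.
  by apply/mnmP => i; rewrite mnmBE subnn mnm0E.
by rewrite mpolyX0 mulr1.
Qed.

Lemma der_x1 : der x1 = 0.
Proof. by rewrite /der mderivX mnm1E /= scale0r mulr0. Qed.

Lemma derZ c f : der (c *: f) = c *: der f.
Proof. by rewrite /der mderivZ scalerAr. Qed.

Lemma homog_der d f : is_homog d f -> is_homog d (der f).
Proof.
move=> /dhomogP fd; rewrite /der /mderiv /is_homog mulr_sumr big_seq; apply: rpred_sum => m mf.
rewrite -scalerAr; have [m0|m0] := eqVneq (m ord0) 0%N.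
  by rewrite m0 mul0r scale0r dhomog0.
apply: dhomogZ; rewrite -mpolyXD dhomogX; apply/eqP.
have <- : mdeg m = d by exact: fd.
rewrite /= mdegD mdeg1 !mdegE !big_ord_recl !big_ord0 !mnmBE !mnm1E /=.
by rewrite subn0 addnA subnKC // lt0n.
Qed.

End ProjectiveLine.

(** * The canonical divisor of the line *)

Section CanonicalDivisorLine.
Variable C : numClosedFieldType.

Local Notation P1 := (projective_space C 1).
Local Notation K := (cone_field P1).
Local Notation ev := (cone_ev P1).
Local Notation x0 := (mpolyX C (mnm1 (ord0 : 'I_2))).
Local Notation x1 := (mpolyX C (mnm1 (ord_max : 'I_2))).

Implicit Types (f g : mpoly 2 C) (p q : proj C 1) (h : funfield P1).

Lemma cone_frac (u : K) : exists fg : mpoly 2 C * mpoly 2 C,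
  fg.2 != 0 /\ u = ev fg.1 / ev fg.2.
Proof.
have [f [g [g0 ->]]] := cone_field_frac u.
by exists (f, g); split => //=; rewrite -(videal_projective_space g).
Qed.

(** The extension of [der] to fractions [u = f / g]: from [u g = f], the quotient
rule reads [u' = (f' - u g') / g]. By [cone_derE] the choice of [f] and [g] is
immaterial. *)
Definition cone_der (u : K) : K :=
  let: (f, g) := sval (cid (cone_frac u)) in
  (ev (der f) - u * ev (der g)) / ev g.

Lemma cone_derE f g (u : K) : g != 0 -> u * ev g = ev f ->
  cone_der u = (ev (der f) - u * ev (der g)) / ev g.
Proof.
move=> g0 uE; rewrite /cone_der; case: cid => -[f' g'] /= [g'0 u'E].
rewrite -!ev_eq0 in g0 g'0.
have {}u'E : u * ev g' = ev f' by rewrite u'E divfK.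
have fgE : f * g' = f' * g.
  by apply: ev_inj; rewrite !rmorphM /= -uE -u'E; ring.
have := congr1 ev (congr1 (@der C) fgE).
rewrite !derM !rmorphD !rmorphM /= -uE -u'E => e.
apply/eqP; rewrite eqr_div //; apply/eqP; rewrite !mulrBl.
move/eqP: e; rewrite -subr_eq0 => /eqP e.
by apply/eqP; rewrite -subr_eq0; apply/eqP; rewrite -[RHS]oppr0 -[in RHS]e; ring.
Qed.

Lemma cone_derD (u v : K) : cone_der (u + v) = cone_der u + cone_der v.
Proof.
have [[f g] /= [g0 uE]] := cone_frac u; have [[k l] /= [l0 vE]] := cone_frac v.
have evg0 := g0; have evl0 := l0; rewrite -!ev_eq0 in evg0 evl0.
have uE' : u * ev g = ev f by rewrite uE divfK.
have vE' : v * ev l = ev k by rewrite vE divfK.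
rewrite (cone_derE g0 uE') (cone_derE l0 vE').
rewrite (@cone_derE (f * l + k * g) (g * l)); first last.
- by rewrite rmorphD !rmorphM /= -uE' -vE'; ring.
- by rewrite mulf_neq0.
rewrite !derD !derM !rmorphD !rmorphM /= -uE' -vE'.
by field; rewrite evg0 evl0.
Qed.

Lemma cone_derM (u v : K) : cone_der (u * v) = cone_der u * v + u * cone_der v.
Proof.
have [[f g] /= [g0 uE]] := cone_frac u; have [[k l] /= [l0 vE]] := cone_frac v.
have evg0 := g0; have evl0 := l0; rewrite -!ev_eq0 in evg0 evl0.
have uE' : u * ev g = ev f by rewrite uE divfK.
have vE' : v * ev l = ev k by rewrite vE divfK.
rewrite (cone_derE g0 uE') (cone_derE l0 vE').
rewrite (@cone_derE (f * k) (g * l)); first last.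
- by rewrite !rmorphM /= -uE' -vE'; ring.
- by rewrite mulf_neq0.
rewrite !derM !rmorphD !rmorphM /= -uE' -vE'.
by field; rewrite evg0 evl0.
Qed.

Lemma cone_derC c : cone_der (ev (mpolyC 2 c)) = 0.
Proof.
rewrite (@cone_derE (mpolyC 2 c) 1) ?oner_neq0 ?rmorph1 ?mulr1 //.
by rewrite derC -mpolyC1 derC !raddf0 mulr0 subrr mul0r.
Qed.

Lemma ratfun_cone_der h : ratfun (cone_der (\val h)).
Proof.
have [d [f [g [fd gd g0 hE]]]] := funfield_frac h.
have evg0 := g0; rewrite -ev_eq0 in evg0.
apply/asboolP; exists (d + d)%N, (der f * g - f * der g), (g * g); split.
- by apply: rpredB; apply: is_homogM => //; exact: homog_der.
- exact: is_homogM.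
- by rewrite videal_projective_space mulf_neq0.
rewrite (@cone_derE f g) // hE ?divfK // rmorphB !rmorphM /=.
by field.
Qed.

(** The derivation [d/dt] of the function field *)
Definition ddt h : funfield P1 := exist _ (cone_der (\val h)) (ratfun_cone_der h).

Lemma is_derivation_ddt (s : funfield P1) : is_derivation (fun h => s * ddt h).
Proof.
split => [h k|h k|h c hE].
- rewrite -mulrDr; congr (_ * _); apply: val_inj.
  by rewrite rmorphD /=; exact: cone_derD.
- have -> : ddt (h * k) = ddt h * k + h * ddt k.
    by apply: val_inj; rewrite rmorphD !rmorphM /=; exact: cone_derM.
  by ring.
- have -> : ddt h = 0 by apply: val_inj; rewrite rmorph0 /= hE cone_derC.
  by rewrite mulr0.
Qed.

Lemma regular_at_frac d f g h p : is_homog d f -> is_homog d g ->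
  ~ vanishes_at g p -> \val h = ev f / ev g -> regular_at p h.
Proof. by move=> fd gd gp hE; exists f, g; split => //; exists d. Qed.

Lemma vanishes_neq0 f p : ~ vanishes_at f p -> f != 0.
Proof. by apply: contra_notN => /eqP ->; rewrite /vanishes_at raddf0. Qed.

Lemma unit_at_frac d f g h p : is_homog d f -> is_homog d g ->
  ~ vanishes_at f p -> ~ vanishes_at g p -> \val h = ev f / ev g -> unit_at p h.
Proof.
move=> fd gd fp gp hE; split.
- by rewrite -(inj_eq val_inj) hE rmorph0 mulf_neq0 ?invr_eq0 ?ev_eq0 //
    ?(vanishes_neq0 fp) ?(vanishes_neq0 gp).
- exact: regular_at_frac fd gd gp hE.
- by apply: (regular_at_frac gd fd) => //; rewrite fmorphV /= hE invf_div.
Qed.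

Lemma unit_at1 p : unit_at p (1 : funfield P1).
Proof.
apply: (@unit_at_frac 0%N 1 1); rewrite ?/is_homog ?dhomog1 ?rmorph1 ?divr1 //;
  by rewrite /vanishes_at rmorph1; apply/eqP; exact: oner_neq0.
Qed.

(** The rational function [t ^ 2] *)
Definition tsq : funfield P1 := ratio (x0 ^+ 2) (x1 ^+ 2).

Lemma homogX2 (i : 'I_2) : is_homog 2 (mpolyX C (mnm1 i) ^+ 2).
Proof. by have := is_homogXn 2 (homogX C i). Qed.

Lemma mpolyX_neq0 (i : 'I_2) : mpolyX C (mnm1 i) != 0.
Proof.
by apply/eqP => /(congr1 (meval (fun=> 1))); rewrite mevalXU raddf0; apply/eqP; exact: oner_neq0.
Qed.

Lemma val_tsq : \val tsq = ev x0 ^+ 2 / ev x1 ^+ 2.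
Proof. by rewrite (val_ratio (homogX2 _) (homogX2 _)) ?expf_neq0 ?mpolyX_neq0 // !rmorphXn. Qed.

Lemma vanishes_atX (i : 'I_2) k p : vanishes_at (mpolyX C (mnm1 i) ^+ k.+1) p <-> hcoord p i = 0.
Proof.
rewrite /vanishes_at rmorphXn /= mevalXU; split => [/eqP|->]; last by rewrite expr0n.
by rewrite expf_eq0 => /eqP.
Qed.

(** The divisor of the 1-form [dt]. The point at infinity is [hcoord p ord_max = 0];
the local parameter there is [1 / t], and [dt = - t ^ 2 d(1 / t)]. *)
Definition Kline p : funfield P1 := if hcoord p ord_max == 0 then tsq else 1.

Lemma tsq_neq0 : tsq != 0.
Proof.
by rewrite -(inj_eq val_inj) val_tsq rmorph0 mulf_neq0 ?invr_eq0 ?expf_neq0 ?ev_eq0 ?mpolyX_neq0.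
Qed.

Lemma Kline_neq0 p : Kline p != 0.
Proof. by rewrite /Kline; case: ifP; rewrite ?oner_neq0 ?tsq_neq0. Qed.

Lemma hcoord0_neq0 p : hcoord p ord_max = 0 -> hcoord p ord0 <> 0.
Proof.
move=> p1 p0; have [i pi] := hcoord_neq0 p.
by case: (ord2P i) pi => ->; rewrite ?p0 ?p1 eqxx.
Qed.

Lemma is_divisor_Kline : is_divisor Kline.
Proof.
split => [p _|p _]; first exact: Kline_neq0.
have [p1|p1] := eqVneq (hcoord p ord_max) 0.
  exists [set q | vanishes_at x0 q]; split.
  - exact: zclosed_zeros (homogX C _).
  - by rewrite /= -[x0]expr1 vanishes_atX; exact: hcoord0_neq0.
  move=> q _; rewrite /= -[x0]expr1 vanishes_atX => q0; rewrite /Kline p1 eqxx.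
  have [q1|q1] := eqVneq (hcoord q ord_max) 0.
    by rewrite divff ?tsq_neq0 //; exact: unit_at1.
  apply: (unit_at_frac (homogX2 ord_max) (homogX2 ord0)).
  - by rewrite vanishes_atX; apply/eqP.
  - by rewrite vanishes_atX.
  - by rewrite div1r fmorphV /= val_tsq invf_div !rmorphXn.
exists [set q | vanishes_at x1 q]; split.
- exact: zclosed_zeros (homogX C _).
- by rewrite /= -[x1]expr1 vanishes_atX; apply/eqP.
move=> q _; rewrite /= -[x1]expr1 vanishes_atX => /eqP/negPf q1.
by rewrite /Kline (negbTE p1) q1 divr1; exact: unit_at1.
Qed.

(** The numerator of a function that vanishes at [p] is divisible by the linear
form of [p]; dividing the latter by any [k] with [k p != 0] gives a parameter. *)
Lemma local_parameter_line p k : is_homog 1 k -> ~ vanishes_at k p ->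
  local_parameters p (fun _ : 'I_1 => ratio (line_form (hcoord p)) k).
Proof.
move=> kd kp; have k0 := vanishes_neq0 kp.
have ld := homog_line_form (hcoord p); set l := line_form _ in ld *.
have lp : vanishes_at l p by rewrite /vanishes_at meval_line_form mulrC subrr.
split => [_|h [f [g [[d [fd gd hE]] gp /esym/eqP]]]].
  exists l, k; split => //; last by rewrite (lp : meval _ _ = 0) mul0r.
  by exists 1%N; split => //; exact: (val_ratio ld kd k0).
rewrite mulf_eq0 invr_eq0 => /orP[/eqP fp|/eqP//].
have [f1 f1d fE] := homog_vanish_dvd fd fp.
case: d fd gd f1d => [|d] fd gd f1d.
  exists (fun=> 0) => [_|]; last first.
    by rewrite big_ord1 mul0r; apply: val_inj; rewrite hE (vanishes_at_const fd fp) !raddf0 mul0r.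
  apply: (@regular_at_frac 0%N 0 1); rewrite ?/is_homog ?dhomog1 ?dhomog0 ?raddf0 ?mul0r //.
  by rewrite /vanishes_at rmorph1; apply/eqP; exact: oner_neq0.
have fkd : is_homog d.+1 (f1 * k) by rewrite -[d.+1]addn1; exact: is_homogM.
exists (fun=> ratio (f1 * k) g) => [_|].
  by apply: (regular_at_frac fkd gd gp); apply: (val_ratio fkd gd); exact: vanishes_neq0 gp.
rewrite big_ord1; apply: val_inj; rewrite rmorphM /=.
rewrite (val_ratio fkd gd) ?(val_ratio ld kd) ?(vanishes_neq0 gp) //.
have := vanishes_neq0 gp; rewrite hE fE !rmorphM /=.
rewrite -!ev_eq0 in k0 *; move=> g0; field.
by rewrite k0 g0.
Qed.

(** The parameter [u] is normalized so that [Kline p * d/dt] is the dual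
derivation [d/du]. *)
Lemma Kline_local_parameter p : exists2 u : funfield P1,
  local_parameters p (fun _ : 'I_1 => u) & Kline p * ddt u = 1.
Proof.
have [p1|p1] := eqVneq (hcoord p ord_max) 0; rewrite /Kline ?p1 ?eqxx ?(negbTE p1).
  have p0 : hcoord p ord0 != 0 by apply/eqP; exact: hcoord0_neq0.
  pose k := hcoord p ord0 *: x0.
  have kd : is_homog 1 k by apply: dhomogZ; exact: homogX.
  have kp : ~ vanishes_at k p.
    by rewrite /vanishes_at mevalZ mevalXU; apply/eqP; rewrite mulf_neq0.
  exists (ratio (line_form (hcoord p)) k); first exact: local_parameter_line.
  have k0 := vanishes_neq0 kp; have ek0 := k0; rewrite -ev_eq0 in ek0.
  apply: val_inj; rewrite rmorphM rmorph1 /= val_tsq (val_ratio (homog_line_form _) kd k0).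
  rewrite (@cone_derE (line_form (hcoord p)) k) ?divfK //.
  have c0 : mpolyC 2 (hcoord p ord0) != 0 by rewrite mpolyC_eq0.
  rewrite -!ev_eq0 in c0; have ex0 := mpolyX_neq0 ord0; have ex1 := mpolyX_neq0 ord_max.
  rewrite -!ev_eq0 in ex0 ex1.
  rewrite /line_form p1 /k scale0r sub0r -!scaleNr !derZ der_x0 der_x1.
  rewrite -!mul_mpolyC !rmorphM /= !rmorphN /= !raddf0.
  by field; rewrite c0 ex0 ex1.
pose k := hcoord p ord_max *: x1.
have kd : is_homog 1 k by apply: dhomogZ; exact: homogX.
have kp : ~ vanishes_at k p.
  by rewrite /vanishes_at mevalZ mevalXU; apply/eqP; rewrite mulf_neq0.
exists (ratio (line_form (hcoord p)) k); first exact: local_parameter_line.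
have k0 := vanishes_neq0 kp; have ek0 := k0; rewrite -ev_eq0 in ek0.
apply: val_inj; rewrite mul1r rmorph1 /= (val_ratio (homog_line_form _) kd k0).
rewrite (@cone_derE (line_form (hcoord p)) k) ?divfK //.
have -> : der (line_form (hcoord p)) = k.
  by rewrite /line_form -scaleNr derD !derZ der_x0 der_x1 scaler0 addr0.
by rewrite /k derZ der_x1 scaler0 raddf0 mulr0 subr0 divff.
Qed.

Lemma canonical_Kline : canonical_divisor Kline.
Proof.
split; first exact: is_divisor_Kline.
pose t : funfield P1 := ratio x0 x1.
have dt : ddt t = 1.
  apply: val_inj; rewrite rmorph1 /= (val_ratio (homogX _ _) (homogX _ _)) ?mpolyX_neq0 //.
  have ex1 := mpolyX_neq0 ord_max; rewrite -ev_eq0 in ex1.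
  rewrite (@cone_derE x0 x1) ?divfK ?mpolyX_neq0 //.
  by rewrite der_x0 der_x1 raddf0 mulr0 subr0 divff.
exists 1%N, 1, (fun=> t); split; first exact: has_dim_line.
move=> p _; have [u uP du] := Kline_local_parameter p.
exists (fun=> u), (fun _ h => Kline p * ddt h); split => //.
- by move=> _; exact: is_derivation_ddt.
- by move=> i j; rewrite du !ord1 eqxx.
- by rewrite det_mx11 mxE dt mulr1 mul1r divff ?Kline_neq0 //; exact: unit_at1.
Qed.

Lemma val_funfield1 : \val (1 : funfield P1) = 1.
Proof. exact: rmorph1. Qed.

(** Let [h = f / g] be regular at [p] after multiplication by [Kline p]. If [g]
vanishes at [p] then so does [f]; at infinity this holds even if [g] does not
vanish, because of the pole of [t ^ 2]. *)
Lemma section_vanish d f g h p : is_homog d f -> is_homog d g -> g != 0 ->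
  \val h = ev f / ev g -> regular_at p (h * Kline p) ->
  vanishes_at g p \/ hcoord p ord_max = 0 -> vanishes_at f p.
Proof.
move=> fd gd g0 hE [f' [g' [[e [f'd g'd]]]]].
rewrite rmorphM /= hE => hKE g'p gp; have g'0 := vanishes_neq0 g'p.
have eg0 := g0; have eg'0 := g'0; rewrite -!ev_eq0 in eg0 eg'0.
rewrite /Kline in hKE.
have [p1|p1] := eqVneq (hcoord p ord_max) 0; rewrite ?p1 ?eqxx ?(negbTE p1) in hKE gp.
  have ex1 := mpolyX_neq0 ord_max; rewrite -ev_eq0 in ex1.
  have : f * x0 ^+ 2 * g' = f' * (g * x1 ^+ 2).
    apply: ev_inj; move: hKE; rewrite !rmorphM /= val_tsq !expr2 mulf_div => /eqP.
    by rewrite eqr_div ?mulf_neq0 // => /eqP.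
  move=> /(congr1 (meval (hcoord p))); rewrite !mevalM !mevalXU p1.
  rewrite !mulr0 => /eqP; rewrite !mulf_eq0 orbb.
  by move=> /orP[/orP[/eqP//|/eqP/(hcoord0_neq0 p1)]|/eqP/g'p].
case: gp => [gp|/eqP]; last by rewrite (negbTE p1).
have : f * g' = f' * g.
  apply: ev_inj; move: hKE; rewrite val_funfield1 mulr1 !rmorphM /= => /eqP.
  by rewrite eqr_div // => /eqP.
move=> /(congr1 (meval (hcoord p))); rewrite !mevalM (gp : meval _ _ = 0) mulr0.
by move/eqP; rewrite mulf_eq0 => /orP[/eqP//|/eqP/g'p].
Qed.

(** Descent on the degree of [f] and [g] in [h = f / g] *)
Lemma Kline_section0 h : is_section Kline h -> h = 0.
Proof.
move=> hK; have [d [f [g [fd gd g0 hE]]]] := funfield_frac h.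
elim: d f g fd gd g0 hE => [|d IH] f g fd gd g0 hE.
  have [|p pP] := @proj_point C 1 (fun i => if i == ord0 then 1 else 0).
    by exists ord0; exact: oner_neq0.
  have p1 : hcoord p ord_max = 0.
    by apply/(vanishes_atX ord_max 0 p); rewrite (pP 1%N) ?expr1 ?homogX // mevalXU.
  have fp := section_vanish fd gd g0 hE (hK p I) (or_intror p1).
  by apply: val_inj; rewrite hE (vanishes_at_const fd fp) !raddf0 mul0r.
have [v v0 gv] := homog_root (ltn0Sn d) gd.
have [p pP] := proj_point v0; have gp : vanishes_at g p by apply/(pP _ _ gd).
have fp := section_vanish fd gd g0 hE (hK p I) (or_introl gp).
have [f1 f1d fE] := homog_vanish_dvd fd fp; have [g1 g1d gE] := homog_vanish_dvd gd gp.
have [l0 g10] : line_form (hcoord p) != 0 /\ g1 != 0.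
  by apply/andP; rewrite -negb_or -mulf_eq0 -gE.
apply: (IH f1 g1) => //; rewrite hE fE gE !rmorphM /=.
by rewrite -mulf_div divff ?mul1r // ev_eq0.
Qed.

Lemma Kline_not_globally_generated : ~ globally_generated Kline.
Proof.
have [[p _] _] := @zirreducibleT C 1; move=> /(_ p I) [h [/Kline_section0 -> []]].
by rewrite mul0r eqxx.
Qed.

Lemma Fu_line : Fu P1 <> Some 0%N.
Proof.
rewrite /Fu; case: pselect => // h [].
case: ex_minnP => m /asboolP Fm _ m0; rewrite {m}m0 in Fm.
apply: Kline_not_globally_generated.
pose L := fun (_ : 'I_0) (_ : proj C 1) => 1 : funfield P1.
have L0 i : ample (L i) by case: i.
have := @Fm 0%N isT L L0 Kline canonical_Kline.
by congr (globally_generated _); apply/funext => p; rewrite big_ord0 mulr1.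
Qed.

End CanonicalDivisorLine.

(** * The classical topology of projective space *)

Section ProjectiveTopology.
Variables (C : numClosedFieldType) (n : nat).
Implicit Types (p q : proj C n) (i k : 'I_n.+1).

Lemma hcoord_pi (w : @nonzero_vec C n) : exists2 c : C, c != 0 &
  forall i, hcoord (\pi_(proj C n) w) i = c * \val w ord0 i.
Proof.
have /eqmodP/asboolP [c cE] := reprK (\pi_(proj C n) w).
exists c => [|i]; last by rewrite /hcoord cE mxE.
apply/eqP => c0; have := set_mem (valP (repr (\pi_(proj C n) w))).
by rewrite /nonzero_vec /= cE c0 scale0r eqxx.
Qed.

(** A set is open if its cone is cut out by an open set of vectors. *)
Lemma open_proj (V : set 'rV[C]_n.+1) (U : set (proj C n)) : open V ->
  (forall w : @nonzero_vec C n, U (\pi_(proj C n) w) <-> V (\val w)) -> open U.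
Proof.
move=> oV UV; rewrite /open /= /quotient_open.
have -> : \pi_(proj C n) @^-1` U = (@set_val _ (@nonzero_vec C n)) @^-1` V.
  by apply/seteqP; split => w /UV.
by move: V oV {UV}; apply/continuousP; exact: initial_continuous.
Qed.

Lemma cvg_coord k (M : 'rV[C]_n.+1) : v ord0 k @[v --> M] --> M ord0 k.
Proof. exact: coord_continuous. Qed.

Lemma open_coord_neq0 k : open [set p : proj C n | hcoord p k != 0].
Proof.
apply: (@open_proj [set v | v ord0 k != 0]) => [|w]; last first.
  by have [c c0 wE] := hcoord_pi w; rewrite /= wE mulf_eq0 (negbTE c0).
rewrite openE => v /= vk; exact: (cvgr_neq0 _ (@cvg_coord k v) vk).
Qed.

Lemma affine_coord_continuous i k p : hcoord p k != 0 ->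
  {for p, continuous (fun q => hcoord q i / hcoord q k)}.
Proof.
move=> pk W; rewrite nbhsE => -[W' [oW' Op] WW'].
rewrite nbhs_filterE;
  apply: filterS (_ : nbhs p [set q | hcoord q k != 0 /\ W' (hcoord q i / hcoord q k)]).
  by move=> q [_ /WW'].
apply: open_nbhs_nbhs; split => //.
apply: (@open_proj [set v | v ord0 k != 0 /\ W' (v ord0 i / v ord0 k)]) => [|w]; last first.
  have [c c0 wE] := hcoord_pi w; rewrite /= !wE mulf_eq0 (negbTE c0).
  by rewrite -mulf_div divff // mul1r.
rewrite openE => v /= [vk Ov].
apply: filterI; first exact: (cvgr_neq0 _ (@cvg_coord k v) vk).
have : v ord0 i / v ord0 k @[v --> v] --> v ord0 i / v ord0 k.
  by apply: cvgM; [exact: cvg_coord|apply: cvgV => //; exact: cvg_coord].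
by apply; exact: open_nbhs_nbhs.
Qed.

End ProjectiveTopology.

Section ProjectiveLinePoints.
Variable C : numClosedFieldType.

(** [(a, b)] is a nonzero vector. *)
Definition nz (a b : C) := (a != 0) || (b != 0).

(** The row vector [(a, b)], and below the same as a nonzero vector *)
Definition vec2 (a b : C) : 'rV[C]_2 := \row_i if i == ord0 then a else b.

Lemma vec2_neq0 a b : nz a b -> vec2 a b \in @nonzero_vec C 1.
Proof.
move=> ab; rewrite inE /nonzero_vec /=; apply/rV0Pn; case/orP: ab => h.
  by exists ord0; rewrite mxE.
by exists ord_max; rewrite mxE.
Qed.

Definition nzvec a b (ab : nz a b) : @nonzero_vec C 1 := SigSub (vec2_neq0 ab).

(** The point with homogeneous coordinates [a] and [b]. When both are 0 it is the
point with coordinates 1 and 0, an arbitrary choice. *)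
Definition pt (a b : C) : proj C 1 :=
  if pselect (nz a b) is left ab then \pi_(proj C 1) (nzvec ab)
  else \pi_(proj C 1) (@nzvec 1 0 (introT orP (or_introl (oner_neq0 C)))).

Lemma ptE a b (ab : nz a b) : pt a b = \pi_(proj C 1) (nzvec ab).
Proof.
by rewrite /pt; case: pselect => [h|/(_ ab)[]]; rewrite (bool_irrelevance h ab).
Qed.

Lemma pt_cvg (U : Type) (F : set_system U) {FF : Filter F} (f g : U -> C) a b :
  nz a b -> f @ F --> a -> g @ F --> b -> (fun u => pt (f u) (g u)) @ F --> pt a b.
Proof.
move=> ab fa gb W0; rewrite nbhsE => -[W' [oW' W'p] WW'].
have [V oV VE] : exists2 V : set 'rV[C]_2, open V &
  set_val @^-1` V = \pi_(proj C 1) @^-1` W' :> set (@nonzero_vec C 1) by exact: oW'.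
have Vab : V (vec2 a b).
  have : (\pi_(proj C 1) @^-1` W') (nzvec ab) by rewrite /= -ptE.
  by rewrite -VE.
have : (fun u => vec2 (f u) (g u)) @ F --> vec2 a b.
  move=> W1 [Q Qab QW]; change (F ((fun u => vec2 (f u) (g u)) @^-1` W1)).
  have FQ : F (f @^-1` (Q ord0 ord0) `&` g @^-1` (Q ord0 ord_max)).
    apply: filterI; [apply: fa|apply: gb].
      by have := Qab ord0 ord0; rewrite mxE.
    by have := Qab ord0 ord_max; rewrite mxE.
  apply: filterS FQ => u [/= uf ug]; apply: QW => i j; rewrite mxE ord1.
  by case: (ord2P j) => ->.
move=> /(_ V (open_nbhs_nbhs (conj oV Vab))) FV.
have nzF : \forall u \near F, nz (f u) (g u).
  case/orP: (ab) => h.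
    by apply: filterS (cvgr_neq0 _ fa h) => u hu; rewrite /nz hu.
  by apply: filterS (cvgr_neq0 _ gb h) => u hu; rewrite /nz hu orbT.
change (F ((fun u => pt (f u) (g u)) @^-1` W0)); apply: filterS2 nzF FV => u fgu Vu; apply: WW'.
have : (set_val @^-1` V) (nzvec fgu) by [].
by rewrite VE /= -ptE.
Qed.

Lemma nz_hcoord (p : proj C 1) : nz (hcoord p ord0) (hcoord p ord_max).
Proof.
by have [i pi] := hcoord_neq0 p; rewrite /nz; case: (ord2P i) pi => -> ->; rewrite ?orbT.
Qed.

Lemma pt_hcoord (p : proj C 1) : pt (hcoord p ord0) (hcoord p ord_max) = p.
Proof.
rewrite (ptE (nz_hcoord p)) -[RHS]reprK; congr (\pi_(proj C 1) _); apply: val_inj => /=.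
by apply/rowP => i; rewrite mxE; case: (ord2P i) => ->.
Qed.

Lemma pt_scale (c a b : C) : c != 0 -> nz a b -> pt (c * a) (c * b) = pt a b.
Proof.
move=> c0 ab; have cab : nz (c * a) (c * b) by rewrite /nz !mulf_eq0 (negbTE c0).
rewrite (ptE cab) (ptE ab); apply/eqmodP/asboolP; exists c.
by apply/rowP => i; rewrite !mxE; case: ifP.
Qed.

Lemma pt_eq (a b a' b' : C) : nz a b -> nz a' b' -> pt a b = pt a' b' ->
  exists2 c : C, c != 0 & a = c * a' /\ b = c * b'.
Proof.
move=> ab ab'; rewrite (ptE ab) (ptE ab') => /eqmodP/asboolP [c /= /rowP e].
have := e ord0; have := e ord_max; rewrite !mxE /= => eb ea.
exists c => //; apply: contraTneq ab => c0.
by rewrite ea eb c0 !mul0r /nz eqxx.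
Qed.

End ProjectiveLinePoints.

(** * Gluing along the unit interval *)

Section IntervalLemmas.
Variable R : realType.

(** A property of nondegenerate subintervals of the unit interval that holds
locally and is stable under concatenation holds for the whole interval. *)
Lemma interval_ind (Q : R -> R -> Prop) :
  (forall a b c, 0 <= a -> a < b -> b < c -> c <= 1 -> Q a b -> Q b c -> Q a c) ->
  (forall x, 0 <= x <= 1 -> exists2 e, 0 < e &
     forall a b, 0 <= a -> a < b -> b <= 1 -> x - e < a -> b < x + e -> Q a b) ->
  Q 0 1.
Proof.
move=> Qcat Qloc.
(* The supremum of the b such that b = 0 or Q 0 b is attained and equals 1. *)
pose S := [set b : R | 0 <= b <= 1 /\ (0 < b -> Q 0 b)].
have S0 : S 0 by split; rewrite ?lexx ?ler01 ?ltxx.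
have supS : has_sup S by split; [exists 0|exists 1 => b [/andP[_ ->]]].
have S1 b : S b -> b <= sup S by move=> Sb; apply: ub_le_sup => //; exact: supS.2.
have s01 : 0 <= sup S <= 1.
  by rewrite S1 //=; apply: ge_sup => [|b [/andP[_ ->]]]; first by exists 0.
have [e e0 Qe] := Qloc _ s01.
have [b [b01 Qb] be] := sup_adherent e0 supS.
have [bc|cb] := ltP b (Num.min 1 (sup S + e / 2)); last first.
  have bs := S1 b (conj b01 Qb); move: cb; rewrite ge_min => /orP[b1|]; last by lra.
  have b1E : b = 1 by lra.
  by rewrite -b1E; apply: Qb; lra.
set c := Num.min _ _ in bc.
have [c1 cs] : c <= 1 /\ c <= sup S + e / 2 by rewrite !ge_min !lexx orbT.
have Qbc : Q b c by apply: Qe; lra.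
have Q0c : Q 0 c.
  have [b0|b0] := ltP 0 b; first by apply: Qcat Qbc => //; [exact: Qb].
  by have <- : b = 0 by lra.
have Sc : S c by split => //; lra.
have := S1 c Sc; rewrite /c ge_min => /orP[s1|]; last by lra.
by rewrite (_ : 1 = c) // /c; apply/esym/min_idPl; lra.
Qed.

Lemma itvccE (a b s : R) : `[a, b]%classic s = (a <= s <= b) :> Prop.
Proof. by rewrite /= in_itv. Qed.

Lemma within_itvW (T : topologicalType) (a b c d : R) (f : R -> T) :
  a <= c -> d <= b -> {within `[a, b], continuous f} -> {within `[c, d], continuous f}.
Proof.
move=> ac db; apply: continuous_subspaceW => s; rewrite !itvccE; lra.
Qed.

(** Concatenation, without reparametrization, of [f] up to [b] and [g] from [b] *)
Definition glue (T : Type) (b : R) (f g : R -> T) : R -> T :=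
  fun s => if s <= b then f s else g s.

Lemma glueE (T : Type) (b : R) (f g : R -> T) : f b = g b ->
  (forall s, s <= b -> glue b f g s = f s) /\ (forall s, b <= s -> glue b f g s = g s).
Proof.
move=> fg; rewrite /glue; split => s; first by move=> ->.
by case: (ltgtP s b) => // ->.
Qed.

Lemma within_glue (T : topologicalType) (a b c : R) (f g : R -> T) : f b = g b ->
  {within `[a, b], continuous f} -> {within `[b, c], continuous g} ->
  {within `[a, c], continuous (glue b f g)}.
Proof.
move=> fg cf cg; have [gf gg] := glueE fg.
apply: (@within_paste R T _ `[a, b]%classic `[b, c]%classic _ f g) => //.
- move=> s; rewrite itvccE => sac; have [sb|bs] := leP s b; [left|right]; rewrite itvccE; lra.
- exact: interval_closed.
- exact: interval_closed.
- by move=> s; rewrite itvccE => /andP[_ /gf ->].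
- by move=> s; rewrite itvccE => /andP[/gg -> _].
Qed.

Lemma near_itv (x : R) (P : R -> Prop) :
  (\forall s \near within `[0, 1] (nbhs x), P s) ->
  exists2 e : R, 0 < e & forall s, 0 <= s <= 1 -> x - e < s < x + e -> P s.
Proof.
rewrite /within /= => /nbhs_ballP [e /= e0 eP]; exists e => // s s01 xs.
apply: eP; last by rewrite /= in_itv.
by rewrite /ball /= ltr_distlC; lra.
Qed.

End IntervalLemmas.

(** * Paths in C^2 minus the origin *)

Section WithinContinuity.
Variables (C : numClosedFieldType) (U : topologicalType) (D : set U).
Implicit Types f g : U -> C.

Lemma within_cst (W : topologicalType) (c : W) : {within D, continuous (fun=> c : W)}.
Proof. by apply: continuous_subspaceT; exact: cst_continuous. Qed.

Lemma withinD f g : {within D, continuous f} -> {within D, continuous g} ->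
  {within D, continuous (fun u => f u + g u)}.
Proof.
move=> /subspace_continuousP cf /subspace_continuousP cg.
by apply/subspace_continuousP => u Du; apply: cvgD; [exact: cf|exact: cg].
Qed.

Lemma withinM f g : {within D, continuous f} -> {within D, continuous g} ->
  {within D, continuous (fun u => f u * g u)}.
Proof.
move=> /subspace_continuousP cf /subspace_continuousP cg.
by apply/subspace_continuousP => u Du; apply: cvgM; [exact: cf|exact: cg].
Qed.

Lemma within_div f g : (forall u, D u -> g u != 0) ->
  {within D, continuous f} -> {within D, continuous g} ->
  {within D, continuous (fun u => f u / g u)}.
Proof.
move=> g0 /subspace_continuousP cf /subspace_continuousP cg.
by apply/subspace_continuousP => u Du; apply: cvgM; [exact: cf|apply: cvgV; [exact: g0|exact: cg]].
Qed.

Lemma within_pt f g : (forall u, D u -> nz (f u) (g u)) ->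
  {within D, continuous f} -> {within D, continuous g} ->
  {within D, continuous (fun u => pt (f u) (g u))}.
Proof.
move=> g0 /subspace_continuousP cf /subspace_continuousP cg.
by apply/subspace_continuousP => u Du; apply: pt_cvg; [exact: g0|exact: cf|exact: cg].
Qed.

End WithinContinuity.

Section Lifting.
Variables (R : realType) (C : numClosedFieldType).

(** A path in P^1 lifts to C^2 minus the origin. Where the k-th coordinate does not
vanish, dividing by it gives a lift, which is then scaled to start at a
prescribed vector. *)
Lemma lift_path (gamma : R -> proj C 1) : {within `[0, 1], continuous gamma} ->
  exists g0 g1 : R -> C, [/\ {within `[0, 1], continuous g0}, {within `[0, 1], continuous g1} &
    forall s, 0 <= s <= 1 -> nz (g0 s) (g1 s) /\ gamma s = pt (g0 s) (g1 s)].
Proof.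
move=> cgamma.
pose Q (a b : R) := forall u v : C, nz u v -> gamma a = pt u v ->
  exists g0 g1 : R -> C, [/\ {within `[a, b], continuous g0}, {within `[a, b], continuous g1},
    forall s, a <= s <= b -> nz (g0 s) (g1 s) /\ gamma s = pt (g0 s) (g1 s), g0 a = u & g1 a = v].
suff Q01 : Q 0 1.
  have [g0 [g1 [c0 c1 gP _ _]]] := Q01 _ _ (nz_hcoord (gamma 0)) (esym (pt_hcoord (gamma 0))).
  by exists g0, g1.
apply: interval_ind => [a b c a0 ab bc c1 Qab Qbc u v uv gauv|x x01].
  have [g0 [g1 [cg0 cg1 gP g0a g1a]]] := Qab u v uv gauv.
  have [|nzb gb] := gP b; first by rewrite lexx ltW.
  have [h0 [h1 [ch0 ch1 hP h0b h1b]]] := Qbc _ _ nzb gb.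
  have [e0 e0'] := glueE (esym h0b); have [e1 e1'] := glueE (esym h1b).
  exists (glue b g0 h0), (glue b g1 h1); split; rewrite ?e0 ?e1 ?(ltW ab) //.
  - exact: within_glue.
  - exact: within_glue.
  - move=> s sac; have [sb|/ltW bs] := leP s b; first by rewrite e0 ?e1 //; apply: gP; lra.
    by rewrite e0' ?e1' //; apply: hP; lra.
have [k xk] := hcoord_neq0 (gamma x).
have cx : gamma s @[s --> within `[0, 1] (nbhs x)] --> gamma x.
  by move/subspace_continuousP: cgamma; apply; rewrite itvccE.
have [e e0 eP] := near_itv (cx _ (open_nbhs_nbhs (conj (@open_coord_neq0 C 1 k) xk))).
exists e => // a b a0 ab b1 ea eb u v uv gauv.
have gk s : a <= s <= b -> hcoord (gamma s) k != 0 by move=> sab; apply: eP; lra.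
pose z i s := hcoord (gamma s) i / hcoord (gamma s) k.
have cz i : {within `[a, b], continuous (z i)}.
  apply/subspace_continuousP => s; rewrite itvccE => sab.
  apply: (@cvg_comp _ _ _ gamma (fun p => hcoord p i / hcoord p k)); last first.
    exact: affine_coord_continuous (gk s sab).
  have : {within `[a, b], continuous gamma} by apply: within_itvW cgamma.
  by move/subspace_continuousP; apply; rewrite itvccE.
have zP s : a <= s <= b -> nz (z ord0 s) (z ord_max s) /\ gamma s = pt (z ord0 s) (z ord_max s).
  move=> /gk sk; have := nz_hcoord (gamma s) => ns; rewrite /z; split.
    by rewrite /nz !mulf_eq0 !invr_eq0 (negbTE sk) !orbF.
  by rewrite ![_ / hcoord _ k]mulrC pt_scale ?invr_eq0 // pt_hcoord.
have [|nza zaE] := zP a; first by rewrite lexx ltW.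
rewrite zaE in gauv; have [c c0 [uE vE]] := pt_eq uv nza (esym gauv).
exists (fun s => c * z ord0 s), (fun s => c * z ord_max s); split => //.
- by apply: withinM => //; exact: within_cst.
- by apply: withinM => //; exact: within_cst.
- move=> s /zP [nzs ->]; rewrite pt_scale //; split => //.
  by move: nzs; rewrite /nz !mulf_eq0 (negbTE c0).
Qed.

(* The inclusion of the real numbers in C *)
Variable iota : {rmorphism R -> C}.
Hypothesis iota_ge0 : forall r, 0 <= r -> 0 <= iota r.
Hypothesis iota_cts : continuous (iota : R -> C).

Lemma iota_itv r : 0 <= r <= 1 -> 0 <= iota r <= 1.
Proof.
move=> /andP[r0 r1]; rewrite iota_ge0 //= -subr_ge0 -(rmorph1 iota) -rmorphB iota_ge0 //; lra.
Qed.

(** Two nonzero points of a disc are joined by a path that avoids the origin and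
stays in the disc of twice the radius: the segment, or, when the segment passes
through 0, an arc of parabola with the same ends. *)
Lemma path_avoiding0 (u v z eps : C) : u != 0 -> v != 0 -> 0 < eps ->
  `|u - z| <= eps -> `|v - z| <= eps -> exists k : R -> C,
  [/\ continuous k, k 0 = u, k 1 = v &
    forall t, 0 <= t <= 1 -> k t != 0 /\ `|k t - z| <= eps + eps].
Proof.
move=> u0 v0 eps0 uz vz.
pose K d (t : R) := (1 - iota t) * u + iota t * v + d * ((1 - iota t) * iota t) * ('i * u).
have cK d : continuous (K d).
  have c1 : continuous (fun t : R => 1 - iota t : C).
    by move=> t; apply: cvgB; [exact: cvg_cst|exact: iota_cts].
  move=> t; apply: cvgD; first (apply: cvgD; apply: cvgM; try exact: cvg_cst).
  - exact: c1.
  - exact: iota_cts.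
  - apply: cvgM; last exact: cvg_cst.
    apply: cvgM; first exact: cvg_cst.
    by apply: cvgM; [exact: c1|exact: iota_cts].
have K0 d : K d 0 = u by rewrite /K rmorph0 !(subr0, mul0r, mulr0, addr0, mul1r).
have K1 d : K d 1 = v by rewrite /K rmorph1 subrr !(subr0, mul0r, mulr0, addr0, mul1r, add0r).
have Kz d t : 0 <= d -> d * `|u| <= eps -> 0 <= t <= 1 -> `|K d t - z| <= eps + eps.
  move=> d0 du /iota_itv; set x := iota t => /andP[x0 x1].
  have x1' : 0 <= 1 - x by rewrite subr_ge0.
  have -> : K d t - z = ((1 - x) * (u - z) + x * (v - z)) + d * ((1 - x) * x) * ('i * u).
    by rewrite /K -/x; ring.
  apply: (le_trans (ler_normD _ _)); apply: lerD.
    apply: (le_trans (ler_normD _ _)); rewrite !normrM (ger0_norm x0) (ger0_norm x1').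
    rewrite (_ : eps = (1 - x) * eps + x * eps); last by ring.
    by apply: lerD; apply: ler_wpM2l.
  rewrite !normrM normCi mul1r (ger0_norm d0) (ger0_norm x0) (ger0_norm x1') mulrAC.
  apply: le_trans du; rewrite ler_piMr ?mulr_ge0 //.
  by apply: mulr_ile1 => //; rewrite gerBl.
have [[t0 ht0 Kt0]|noz] := pselect (exists2 t : R, 0 <= t <= 1 & K 0 t = 0); last first.
  exists (K 0); split => // t t01; split; last by apply: Kz; rewrite ?mul0r ?lexx ?(ltW eps0).
  by apply/eqP => Kt; apply: noz; exists t.
have nu : 0 < `|u| by rewrite normr_gt0.
pose d := eps / `|u|.
have d0 : 0 < d by rewrite divr_gt0.
exists (K d); split => // t t01; split; last first.
  by apply: Kz => //; [exact: ltW|rewrite divfK ?normr_eq0].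
have xr s : 0 <= s <= 1 -> iota s \is Num.real by move=> /iota_itv/andP[? _]; exact: ger0_real.
set y := iota t0 in Kt0; have yr : y \is Num.real by exact: xr.
have y0 : y != 0.
  apply: contra_neq u0 => y0; move: Kt0; rewrite /K -/y y0.
  by rewrite !(subr0, mul0r, mulr0, addr0, mul1r).
(* v is a negative multiple of u, so K d t / u has real part 1 - x - x (1 - y) / y
   and imaginary part d (1 - x) x. *)
have vE : v = - ((1 - y) / y) * u.
  apply: (mulfI y0); rewrite mulrA mulrN mulrCA divff // mulr1 mulNr.
  by apply/eqP; rewrite -subr_eq0 opprK addrC; apply/eqP; move: Kt0; rewrite /K -/y !mul0r addr0.
set x := iota t; have xrt : x \is Num.real by exact: xr.
have KE : K d t = ((1 - x - x * ((1 - y) / y)) + 'i * (d * ((1 - x) * x))) * u.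
  by rewrite /K -/x vE; ring.
rewrite KE mulf_neq0 //; apply/eqP => e.
have Ar : 1 - x - x * ((1 - y) / y) \is Num.real by rewrite !(rpredB, rpredM, rpredV, rpred1).
have Br : d * ((1 - x) * x) \is Num.real.
  by apply: realM; [exact: gtr0_real|apply: realM => //; apply: realB => //; exact: real1].
have A0 := Re_rect Ar Br; have B0 := Im_rect Ar Br; rewrite e !raddf0 in A0 B0.
move/esym/eqP: B0; rewrite mulf_eq0 (gt_eqF d0) mulf_eq0 /= subr_eq0 => /orP[/eqP x1|/eqP x0].
  move: A0; rewrite -x1 subrr sub0r mul1r => /esym/eqP.
  rewrite oppr_eq0 mulf_eq0 invr_eq0 (negbTE y0) orbF.
  rewrite subr_eq0 => /eqP y1; move: v0; rewrite vE -y1 subrr mul0r oppr0 mul0r eqxx //.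
by move: A0; rewrite x0 subr0 mul0r subr0 => /esym/eqP; rewrite oner_eq0.
Qed.

End Lifting.

(** * Simple connectedness of the line *)

Section SimplyConnected.
Variables (R : realType) (C : numClosedFieldType).

Lemma no_common_zero_bound (g h : R -> C) :
  {within `[0, 1], continuous g} -> {within `[0, 1], continuous h} ->
  (forall s, 0 <= s <= 1 -> nz (g s) (h s)) ->
  exists2 e : C, 0 < e & forall s, 0 <= s <= 1 -> g s = 0 -> e <= `|h s|.
Proof.
move=> /subspace_continuousP cg /subspace_continuousP ch gh.
pose Q (a b : R) := exists2 e : C, 0 < e & forall s, a <= s <= b -> g s = 0 -> e <= `|h s|.
apply: (@interval_ind R Q) => [a b c _ ab bc _ [e e0 eP] [e' e'0 e'P]|x x01].
  (* The order of C is partial: this bound replaces the minimum of e and e'. *)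
  exists (e * e' / (e + e')); first by rewrite divr_gt0 ?mulr_gt0 ?addr_gt0.
  have [le le'] : e * e' / (e + e') <= e /\ e * e' / (e + e') <= e'.
    by rewrite !ler_pdivrMr ?addr_gt0 // !mulrDr [e' * e]mulrC lerDl lerDr !mulr_ge0 ?ltW.
  move=> s sac gs; have [sb|/ltW bs] := leP s b.
    by apply: (le_trans le); apply: eP => //; lra.
  by apply: (le_trans le'); apply: e'P => //; lra.
have Ix : `[0, 1]%classic x by rewrite itvccE.
have [gx|gx] := eqVneq (g x) 0; last first.
  have [r r0 rP] := near_itv (cvgr_neq0 _ (cg x Ix) gx).
  exists r => // a b a0 ab b1 ra rb; exists 1 => // s sab gs.
  by have /eqP := rP s ltac:(lra) ltac:(lra).
have hx : h x != 0 by have := gh x x01; rewrite /nz gx eqxx.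
have nh : 0 < `|h x| / 2 by rewrite divr_gt0 ?normr_gt0 ?ltr0n.
have /cvgrPdist_lt/(_ _ nh)/near_itv[r r0 rP] := ch x Ix.
exists r => // a b a0 ab b1 ra rb; exists (`|h x| / 2) => // s sab _.
have := rP s ltac:(lra) ltac:(lra); move=> /ltW hxs.
rewrite -(lerD2l (`|h x| / 2)) -splitr.
apply: (@le_trans _ _ (`|h x - h s| + `|h s|)); last by rewrite lerD2r.
by apply: le_trans (ler_normD _ _); rewrite subrK.
Qed.

(* The inclusion of the real numbers in C *)
Variable iota : {rmorphism R -> C}.
Hypothesis iota_ge0 : forall r, 0 <= r -> 0 <= iota r.
Hypothesis iota_cts : continuous (iota : R -> C).

(** A path in C whose ends are nonzero is close to a path with the same ends that
avoids 0. In the induction the ends may be moved by [e], which lets intermediate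
ends be nonzero; on an interval where [h] varies by at most [e] the new path is
within [2 * 2 e] of [h a], hence within [5 e] of [h]. *)
Lemma perturb_nonzero (h : R -> C) (e : C) : {within `[0, 1], continuous h} -> 0 < e ->
  h 0 != 0 -> h 1 != 0 -> exists k : R -> C,
  [/\ {within `[0, 1], continuous k}, k 0 = h 0, k 1 = h 1 &
    forall s, 0 <= s <= 1 -> k s != 0 /\ `|k s - h s| <= e *+ 5].
Proof.
move=> /subspace_continuousP ch e0 h0 h1.
pose Q (a b : R) := forall u v : C, u != 0 -> v != 0 -> `|u - h a| <= e -> `|v - h b| <= e ->
  exists k : R -> C, [/\ {within `[a, b], continuous k}, k a = u, k b = v &
    forall s, a <= s <= b -> k s != 0 /\ `|k s - h s| <= e *+ 5].
suff Q01 : Q 0 1 by apply: Q01 => //; rewrite subrr normr0 ltW.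
apply: interval_ind => [a b c _ ab bc _ Qab Qbc u v u0 v0 uh vh|x x01].
  have [w w0 wh] : exists2 w, w != 0 & `|w - h b| <= e.
    have [hb|hb] := eqVneq (h b) 0; last by exists (h b); rewrite ?subrr ?normr0 ?ltW.
    by exists e; rewrite ?gt_eqF // hb subr0 gtr0_norm.
  have [k [ck ka kb kP]] := Qab _ _ u0 w0 uh wh.
  have [l [cl lb lc lP]] := Qbc _ _ w0 v0 wh vh.
  have klb : k b = l b by rewrite kb lb.
  have [Gk Gl] := glueE klb.
  exists (glue b k l); split.
  - exact: within_glue.
  - by rewrite Gk // ltW.
  - by rewrite Gl // ltW.
  move=> s sac; have [sb|/ltW bs] := leP s b.
    by rewrite Gk //; apply: kP; lra.
  by rewrite Gl //; apply: lP; lra.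
have Ix : `[0, 1]%classic x by rewrite itvccE.
have e20 : 0 < e / 2 by rewrite divr_gt0 ?ltr0n.
have /cvgrPdist_lt/(_ _ e20)/near_itv[r r0 rP] := ch x Ix.
exists r => // a b a0 ab b1 ra rb u v u0 v0 uh vh.
have hh s s' : a <= s <= b -> a <= s' <= b -> `|h s - h s'| <= e.
  move=> sab sab'; rewrite [e]splitr.
  have := rP s ltac:(lra) ltac:(lra); have := rP s' ltac:(lra) ltac:(lra).
  move=> /ltW xs' /ltW xs; rewrite distrC in xs.
  by rewrite -(subrK (h x) (h s)) -addrA; apply: (le_trans (ler_normD _ _)); exact: lerD.
have uh' : `|u - h a| <= e *+ 2 by apply: (le_trans uh); rewrite mulr2n lerDl ltW.
have vh' : `|v - h a| <= e *+ 2.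
  rewrite -(subrK (h b) v) -addrA mulr2n; apply: (le_trans (ler_normD _ _)).
  by apply: lerD => //; apply: hh; lra.
have e2 : 0 < e *+ 2 by rewrite pmulrn_lgt0.
have [k [ck k0 k1 kP]] := path_avoiding0 iota_ge0 iota_cts u0 v0 e2 uh' vh'.
have ba : b - a != 0 by rewrite subr_eq0 gt_eqF.
exists (fun s => k ((s - a) / (b - a))); split.
- apply: continuous_subspaceT => s.
  apply: (@continuous_comp _ _ _ (fun s => (s - a) / (b - a)) k); last exact: ck.
  apply: cvgM; last exact: cvg_cst.
  by apply: cvgB; [exact: cvg_id|exact: cvg_cst].
- by rewrite subrr mul0r.
- by rewrite divff.
move=> s sab.
have [|kn kd] := kP ((s - a) / (b - a)).
  by rewrite divr_ge0 ?ler_pdivrMr; lra.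
split => //; rewrite -(subrK (h a) (k _)) -addrA (_ : e *+ 5 = e *+ 2 + e *+ 2 + e); last by ring.
by apply: (le_trans (ler_normD _ _)); apply: lerD => //; apply: hh; lra.
Qed.

Lemma homotopy_end_loop (T : topologicalType) (A : set T) x (g h : R -> T) H :
  is_homotopy A x g h H -> is_loop A x (fun s => H (s, 1)).
Proof.
move=> [cH HA _ _ Hl Hr].
have I1 : `[0, 1]%classic (1 : R) by rewrite itvccE ler01 lexx.
split; [|by move=> s s01; exact: HA|exact: Hl|exact: Hr].
apply: within_comp cH; last by [].
by apply: continuous_pair => s; [exact: cvg_id|exact: cvg_cst].
Qed.

Lemma cst_loop (T : topologicalType) (A : set T) x : A x -> @is_loop R T A x (fun=> x).
Proof. by move=> Ax; split => //; apply: within_cst. Qed.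

(** [H1] moves the lift [(g0, h)] to [(g0, k)] along segments, where [k] has no
zeros; [H2] contracts the affine coordinate [y = g0 / k] to its value at the base
point. Both are written in the coordinates [x0] and [x1 - c x0], so that the
second homogeneous coordinate is that of the lift plus [c] times the first. *)
Lemma null_homotopic (x : proj C 1) (gamma : R -> proj C 1) : is_loop setT x gamma ->
  exists (gamma' : R -> proj C 1) (H1 H2 : R * R -> proj C 1),
    is_homotopy setT x gamma gamma' H1 /\ is_homotopy setT x gamma' (fun=> x) H2.
Proof.
move=> [cgamma _ gamma0 gamma1].
have [g0 [g1 [cg0 cg1 gP]]] := lift_path cgamma.
have I0 : 0 <= (0 : R) <= 1 by rewrite lexx ler01.
have I1 : 0 <= (1 : R) <= 1 by rewrite lexx ler01.
have [nz0 gam0] := gP 0 I0; have [nz1 gam1] := gP 1 I1.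
have [l l0 [g0E g1E]] : exists2 l : C, l != 0 & g0 1 = l * g0 0 /\ g1 1 = l * g1 0.
  by apply: pt_eq => //; rewrite -gam0 -gam1 gamma1.
(* The linear form g1 - c g0 does not vanish at the base point. *)
have [c hc] : exists c : C, g1 0 - c * g0 0 != 0.
  have [g10|g10] := eqVneq (g1 0) 0; last by exists 0; rewrite mul0r subr0.
  by exists 1; rewrite g10 sub0r mul1r oppr_eq0; move: nz0; rewrite /nz g10 eqxx orbF.
pose h s := g1 s - c * g0 s.
have ch : {within `[0, 1], continuous h}.
  rewrite (_ : h = fun s => g1 s + - c * g0 s); last by apply/funext => s; rewrite /h mulNr.
  by apply: withinD => //; apply: withinM => //; exact: within_cst.
have hE s : h s + c * g0 s = g1 s by rewrite subrK.
have nzh s : 0 <= s <= 1 -> nz (g0 s) (h s).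
  by move=> /gP [+ _]; rewrite /nz /h; case: eqP => // ->; rewrite mulr0 subr0.
have [e e0 eP] := no_common_zero_bound cg0 ch nzh.
have h10 : h 1 != 0 by rewrite /h g0E g1E mulrCA -mulrBr mulf_neq0.
have e6 : 0 < e / 6%:R by rewrite divr_gt0 ?ltr0n.
have [k [ck k0 k1 kP]] := perturb_nonzero ch e6 hc h10.
have k5 : (e / 6%:R) *+ 5 < e.
  by rewrite -mulr_natr mulrAC ltr_pdivrMr ?ltr0n // ltr_pM2l // ltr_nat.
have fst_within (W : topologicalType) (f : R -> W) : {within `[0, 1], continuous f} ->
    {within `[0, 1] `*` `[0, 1], continuous (fun u : R * R => f u.1)}.
  apply: (@within_comp (R * R)%type R W _ _ fst) => [u|u []//]; exact: cvg_fst.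
have t_within : {within `[0, 1] `*` `[0, 1], continuous (fun u : R * R => iota u.2)}.
  apply: continuous_subspaceT => u; apply: continuous_comp; [exact: cvg_snd|exact: iota_cts].
have t'_within : {within `[0, 1] `*` `[0, 1], continuous (fun u : R * R => 1 - iota u.2)}.
  move=> u; apply: cvgB; [exact: cvg_cst|exact: t_within].
pose F (u : R * R) := (1 - iota u.2) * h u.1 + iota u.2 * k u.1 + c * g0 u.1.
pose y s := g0 s / k s.
pose m (u : R * R) := (1 - iota u.2) * y u.1 + iota u.2 * y 0.
have yE s : 0 <= s <= 1 -> pt (y s) (1 + c * y s) = pt (g0 s) (k s + c * g0 s).
  move=> /kP [ks0 _]; rewrite -(@pt_scale _ (k s)) //.
    by congr pt; rewrite /y; field.
  rewrite /nz; have [->|//] := eqVneq (y s) 0; by rewrite mulr0 addr0 oner_eq0.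
have y0E : pt (y 0) (1 + c * y 0) = x by rewrite yE // k0 hE -gam0.
have y1 : y 1 = y 0.
  by rewrite /y k0 k1 /h g0E g1E mulrCA -mulrBr -mulf_div divff // mul1r.
have cm : {within `[0, 1] `*` `[0, 1], continuous m}.
  apply: withinD; apply: withinM => //; last exact: within_cst.
  apply: (fst_within _ y); apply: within_div => //.
  by move=> s; rewrite /= in_itv /= => /kP [].
exists (fun s => pt (g0 s) (k s + c * g0 s)),
  (fun u => pt (g0 u.1) (F u)), (fun u => pt (m u) (1 + c * m u)).
split; split => //=.
- apply: within_pt => [[s t] [/=]|  |].
    (* At a common zero, g0 s = 0 and h s = t (h s - k s), so |h s| < e. *)
  + rewrite !in_itv /= => s01 /(iota_itv iota_ge0)/andP[t0 t1].
    have := nzh s s01; rewrite /nz /F /=; case: eqP => //= gs hs.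
    rewrite gs mulr0 addr0; apply/eqP => Fs; have := eP s s01 gs; apply/negP.
    have [_ kd] := kP s s01.
    have -> : h s = iota t * (h s - k s).
      by apply/eqP; rewrite -subr_eq0 -Fs; apply/eqP; ring.
    rewrite normrM (ger0_norm t0) distrC -real_ltNge ?ger0_real ?mulr_ge0 ?(ltW e0) //.
    by apply: le_lt_trans k5; apply: le_trans kd; rewrite ler_piMl.
  + exact: fst_within.
  + apply: withinD; last by apply: withinM; [exact: within_cst|exact: fst_within].
    by apply: withinD; apply: withinM => //; exact: fst_within.
- move=> s; rewrite in_itv /= => s01; have [_ ->] := gP s s01.
  by rewrite /F /= rmorph0 subr0 mul1r mul0r addr0 hE.
- by move=> s _; rewrite /F /= rmorph1 subrr mul0r mul1r add0r.
- by move=> t _; rewrite /F /= k0 -mulrDl subrK mul1r hE -gam0.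
- by move=> t _; rewrite /F /= k1 -mulrDl subrK mul1r hE -gam1.
- apply: within_pt => [u _|  |].
  + by rewrite /nz; have [->|//] := eqVneq (m u) 0; rewrite mulr0 addr0 oner_eq0.
  + exact: cm.
  + apply: withinD; first exact: within_cst.
    by apply: withinM => //; exact: within_cst.
- by move=> s; rewrite in_itv /= => s01; rewrite /m /= rmorph0 subr0 mul1r mul0r addr0 yE.
- by move=> s _; rewrite /m /= rmorph1 subrr mul0r mul1r add0r.
- by move=> t _; rewrite /m /= -mulrDl subrK mul1r.
- by move=> t _; rewrite /m /= y1 -mulrDl subrK mul1r.
Qed.

Lemma loops_homotopic_line (x : proj C 1) (g h : loop R setT x) : homotopic g h.
Proof.
pose e : loop R setT x := exist _ _ (@cst_loop _ setT x I).
suff null (f : loop R setT x) : homotopic f e.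
  by apply: (@homotopic_trans R _ setT x e); rewrite // homotopic_sym.
have [f' [H1 [H2 [h1 h2]]]] := null_homotopic (svalP f).
pose f1 : loop R setT x := exist _ _ (homotopy_end_loop h1).
apply: (@homotopic_trans R _ setT x f1); apply/asboolP; [exists H1|exists H2].
  by have [c i s _ l r] := h1; split.
have [_ _ _ en _ _] := h1; have [c i s en' l r] := h2.
split; [exact: c|exact: i| |exact: en'|exact: l|exact: r].
by move=> t t01; rewrite s //= en.
Qed.

End SimplyConnected.

(** * A point and a line *)

Lemma pi1_isomorphic_trivial (R : realType) (T U : topologicalType) (A : set T) (B : set U) :
  (forall x (g h : loop R A x), homotopic g h) ->
  (forall y (g h : loop R B y), homotopic g h) -> pi1_isomorphic R A B.
Proof.
have pi1_eq (V : topologicalType) (D : set V) z (Dhom : forall g h : loop R D z, homotopic g h)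
    (a b : pi1 R D z) : a = b.
  by rewrite -[a]reprK -[b]reprK; apply/eqmodP; exact: Dhom.
move=> hA hB x y Ax By.
have a0 : pi1 R A x := \pi_(pi1 R A x) (exist _ _ (cst_loop R Ax)).
have b0 : pi1 R B y := \pi_(pi1 R B y) (exist _ _ (cst_loop R By)).
exists (fun=> b0); split; last by move=> a b; exact: pi1_eq (hB y) _ _.
by exists (fun=> a0) => a; exact: pi1_eq.
Qed.

Lemma loops_homotopic_point (R : realType) (C : numClosedFieldType) (x : proj C 0)
  (g h : loop R setT x) : homotopic g h.
Proof.
have e (p : proj C 0) : p = x by exact: proj0_unique.
apply/asboolP; exists (fun=> x).
split; [exact: within_cst|by []|move=> s _; exact/esym/e|move=> s _; exact/esym/e|by []|by []].
Qed.

Lemma real_complex_continuous (R : realType) :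
  continuous (real_complex R : R -> (complex R : numClosedFieldType)).
Proof.
move=> r; apply/cvgrPdist_lt => -[e e'] /=; rewrite ltcE /= => /andP[/eqP e'0 e0].
near=> s.
have -> : real_complex R r - real_complex R s = real_complex R (r - s) by rewrite rmorphB.
rewrite normc_def /= expr0n addr0 sqrtr_sqr e'0 ltcR.
near: s; exact: (@cvgr_dist_lt _ _ _ (nbhs r) _ id).
Unshelve. all: by end_near. Qed.

Theorem corollaryE (R : realType) :
  exists (n n' : nat) (X : pvariety (complex R) n) (X' : pvariety (complex R) n'),
    [/\ smooth X /\ zconnected (pv_set X),
        smooth X' /\ zconnected (pv_set X'),
        pi1_isomorphic R (pv_set X) (pv_set X') &
        Fu X <> Fu X'].
Proof.
exists 0%N, 1%N, (projective_space (complex R) 0), (projective_space (complex R) 1); split.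
- by split; [exact: smooth_point|exact/zirreducible_zconnected/zirreducibleT].
- by split; [exact: smooth_line|exact/zirreducible_zconnected/zirreducibleT].
- apply: pi1_isomorphic_trivial => x g h; first exact: loops_homotopic_point.
  apply: (@loops_homotopic_line R (complex R) (real_complex R)) => [r|].
    by rewrite -lecR.
  exact: real_complex_continuous.
- by rewrite Fu_point => e; apply: (@Fu_line (complex R)).
Qed.
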